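(* Let $(S,\mathfrak n,k)$ be a regular local ring and $I$ an $\mathfrak n$-primary ideal of $S$ with $I\subseteq\mathfrak n^2$ and $\ell(S/I)=6$. Assume the local ring $S/I$ is neither Gorenstein nor Burch. Then $\dim S=3$, $\operatorname{r}(S/I)=2$, $\nu(I)=4$, and $S/I$ has an exact pair of zero-divisors.
   Context: $\operatorname{r}$ denotes type ($\dim_k$ of the socle for artinian rings), $\nu(I)$ the minimal number of generators, $\ell$ length. An ideal $J$ of a local ring $(A,\mathfrak n)$ is Burch if $\mathfrak n(J:\mathfrak n)\ne\mathfrak nJ$; a local ring $R$ is Burch if there exist a maximal $\widehat R$-regular sequence $\mathbf x$, a regular local ring $T$ and a Burch ideal $J$ of $T$ with $\widehat R/(\mathbf x)\cong T/J$. A pair $(x,y)$ of elements of the maximal ideal $\mathfrak m$ of $R$ is an exact pair of zero-divisors if $0:_Rx=yR$ and $0:_Ry=xR$. *)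

(* Defs.v *)
From HB Require Import structures.
From mathcomp Require Import all_boot all_algebra.
Set Implicit Arguments. Unset Strict Implicit. Unset Printing Implicit Defensive.
Import GRing.Theory.
Local Open Scope ring_scope.

Definition pset (T : Type) := T -> Prop.

Section CommAlg.
Variable R : comNzRingType.

Definition psub (A B : pset R) := forall x, A x -> B x.
Definition pssub (A B : pset R) := psub A B /\ exists x, B x /\ ~ A x.
Definition peq (A B : pset R) := forall x, A x <-> B x.
Definition pfull : pset R := fun _ => True.
Definition pzero : pset R := fun x => x = 0.

Definition is_ideal (I : pset R) :=
  [/\ I 0, (forall x y, I x -> I y -> I (x + y)) & (forall r x, I x -> I (r * x))].

Definition gen_by (X : pset R) : pset R :=
  fun x => forall J, is_ideal J -> psub X J -> J x.
Definition gen_seq (s : seq R) : pset R := gen_by (fun z => z \in s).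
Definition principal (x : R) : pset R := fun z => exists r, z = r * x.

Definition idprod (I J : pset R) : pset R :=
  gen_by (fun z => exists a b, [/\ I a, J b & z = a * b]).
Definition colon (I J : pset R) : pset R := fun x => forall y, J y -> I (x * y).

Definition unitP (x : R) := exists y, x * y = 1.
Definition nonunit (x : R) := ~ unitP x.
(* local ring: the non-units form an ideal, which is then the maximal ideal *)
Definition local_ring := is_ideal nonunit.

Definition noetherian :=
  forall I, is_ideal I -> exists s : seq R, peq I (gen_seq s).

Definition num_gens (I : pset R) (n : nat) :=
  (exists s : seq R, size s = n /\ peq I (gen_seq s)) /\
  (forall s : seq R, peq I (gen_seq s) -> (n <= size s)%N).

Definition prime_ideal (P : pset R) :=
  [/\ is_ideal P, ~ P 1 & forall a b, P (a * b) -> P a \/ P b].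

Definition prime_chain (P : nat -> pset R) (d : nat) :=
  (forall i, (i <= d)%N -> prime_ideal (P i)) /\
  (forall i, (i < d)%N -> pssub (P i) (P i.+1)).

Definition krull_dim (d : nat) :=
  (exists P, prime_chain P d) /\ ~ (exists P, prime_chain P d.+1).

Definition regular_local :=
  [/\ noetherian, local_ring & exists d, krull_dim d /\ num_gens nonunit d].

Definition radical (I : pset R) : pset R := fun x => exists n, I (x ^+ n).
Definition primary (I : pset R) :=
  [/\ is_ideal I, ~ I 1 & forall a b, I (a * b) -> I a \/ radical I b].
Definition max_primary (I : pset R) := primary I /\ peq (radical I) nonunit.

(* composition series of ideals A = C_0 < C_1 < ... < C_n = B with simple steps;
   ideal_length A B n means  length_R (B/A) = n *)
Definition comp_step (A B : pset R) :=
  pssub A B /\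
  forall C, is_ideal C -> psub A C -> psub C B -> psub C A \/ psub B C.
Definition ideal_length (A B : pset R) (n : nat) :=
  exists C : nat -> pset R,
    [/\ peq (C 0%N) A, peq (C n) B, (forall i, (i <= n)%N -> is_ideal (C i))
      & forall i, (i < n)%N -> comp_step (C i) (C i.+1)].

(* type of an artinian local ring: length (= dim_k) of the socle 0 : m *)
Definition art_type (r : nat) := ideal_length pzero (colon pzero nonunit) r.
(* an artinian local ring is Gorenstein iff its type is 1 *)
Definition art_gorenstein := art_type 1.

Definition burch_ideal (J : pset R) :=
  ~ peq (idprod nonunit (colon J nonunit)) (idprod nonunit J).

Definition exact_zd_pair (x y : R) :=
  [/\ nonunit x, nonunit y,
      (forall z, z * x = 0 <-> principal y z)
    & (forall z, z * y = 0 <-> principal x z)].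

End CommAlg.

(* Burch ring, specialised to an artinian local ring Q (depth 0, Q complete):
   Q is isomorphic to T/J with T regular local and J a Burch ideal of T,
   i.e. there is a surjective ring map T -> Q with kernel J. *)
Definition art_burch (Q : comNzRingType) :=
  exists (T : comNzRingType) (J : pset T) (f : {rmorphism T -> Q}),
    [/\ regular_local T, is_ideal J, burch_ideal J,
        (forall q, exists t, f t = q) & (forall t, f t = 0 <-> J t)].

(* Main.v *)
Require Import Defs.
From HB Require Import structures.
From mathcomp Require Import all_boot all_algebra.
From mathcomp Require Import ring zify.
From Stdlib Require Import Classical ClassicalEpsilon FunctionalExtensionality PropExtensionality.
Set Implicit Arguments. Unset Strict Implicit. Unset Printing Implicit Defensive.
Import GRing.Theory.
Local Open Scope ring_scope.

(** Write n for the maximal ideal of S and d for its dimension. The Burch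
    condition is used only for the presentation S/I: its failure says
    n(I : n) = nI. Since nI lies in n^3 and the square of a minimal generator
    of n does not, the socle of S/I lies in n^2/I. If n^2/I were cyclic, the
    socle would have length one. So the Hilbert function of S/I is (1,2,3),
    (1,2,2,1) or (1,3,2). If d = 2, modulo n^3 the ideal I is spanned by at most
    one quadratic form F. A socle element q of order two gives xq = lF and
    yq = l'F in degree three, forcing q to be a multiple of F. Hence d = 3,
    n^3 = nI, and counting quadratic monomials gives four generators of I.

    For d = 3, multiplication on n/n^2 is a pencil of symmetric bilinear forms
    in three variables. Call p bad if pn + I differs from n^2. The condition
    n^3 = nI excludes forms of rank one, so that distinct bad lines annihilate
    each other, and this leaves room for x and y, both not bad, with xy = 0.

    The facts about regular local rings (independence of monomials of degree two
    and three) are all reduced to Krull's height theorem: n is not the radical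
    of an ideal with fewer than d generators. *)

(** * Ideals *)

Section Ideals.
Variable R : comNzRingType.
Implicit Types (I J K X Y Z P Q M : pset R) (a b x y z : R) (s t : seq R).

Lemma peq_eq X Y : peq X Y -> X = Y.
Proof. by move=> h; apply: functional_extensionality => x; apply: propositional_extensionality. Qed.

Lemma psub_anti X Y : psub X Y -> psub Y X -> X = Y.
Proof. by move=> h1 h2; apply: peq_eq => x; split; [apply: h1|apply: h2]. Qed.

Lemma psub_trans Y X Z : psub X Y -> psub Y Z -> psub X Z.
Proof. by move=> h1 h2 x /h1/h2. Qed.

Lemma not_psub X Y : ~ psub X Y -> exists x, X x /\ ~ Y x.
Proof.
move=> h; apply: NNPP => h2; apply: h => x Xx; apply: NNPP => nY.
by apply: h2; exists x.
Qed.

Lemma ideal_conv I x y : I x -> x = y -> I y.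
Proof. by move=> h <-. Qed.

Lemma ideal_zero I : is_ideal I -> I 0. Proof. by case. Qed.
Lemma ideal_add I x y : is_ideal I -> I x -> I y -> I (x + y).
Proof. by case=> _ + _; apply. Qed.
Lemma ideal_mul I r x : is_ideal I -> I x -> I (r * x).
Proof. by case=> _ _; apply. Qed.
Lemma ideal_mulr I r x : is_ideal I -> I x -> I (x * r).
Proof. by move=> iI Ix; rewrite mulrC; apply: ideal_mul. Qed.
Lemma ideal_opp I x : is_ideal I -> I x -> I (- x).
Proof. by move=> iI Ix; rewrite -mulN1r; apply: ideal_mul. Qed.
Lemma ideal_sub I x y : is_ideal I -> I x -> I y -> I (x - y).
Proof. by move=> iI Ix Iy; apply: ideal_add => //; apply: ideal_opp. Qed.

Lemma pzero_ideal : is_ideal (@pzero R).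
Proof.
split=> [//|x y -> ->|r x ->]; rewrite /pzero.
  by rewrite addr0.
by rewrite mulr0.
Qed.

Definition psum X Y : pset R := fun z => exists x y, [/\ X x, Y y & z = x + y].
Definition pcap X Y : pset R := fun z => X z /\ Y z.

Lemma psum_ideal X Y : is_ideal X -> is_ideal Y -> is_ideal (psum X Y).
Proof.
move=> iX iY; split.
- by exists 0, 0; split; [apply: ideal_zero|apply: ideal_zero|rewrite addr0].
- move=> _ _ [x1 [y1 [h1 h2 ->]]] [x2 [y2 [h3 h4 ->]]].
  by exists (x1 + x2), (y1 + y2); split; [apply: ideal_add|apply: ideal_add|ring].
- move=> r _ [x1 [y1 [h1 h2 ->]]].
  by exists (r * x1), (r * y1); split; [apply: ideal_mul|apply: ideal_mul|ring].
Qed.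

Lemma pcap_ideal X Y : is_ideal X -> is_ideal Y -> is_ideal (pcap X Y).
Proof.
move=> iX iY; split.
- by split; apply: ideal_zero.
- by move=> x y [? ?] [? ?]; split; apply: ideal_add.
- by move=> r x [? ?]; split; apply: ideal_mul.
Qed.

Lemma psub_psuml X Y : is_ideal Y -> psub X (psum X Y).
Proof. by move=> iY x Xx; exists x, 0; split=> //; [apply: ideal_zero|rewrite addr0]. Qed.

Lemma psub_psumr X Y : is_ideal X -> psub Y (psum X Y).
Proof. by move=> iX x Xx; exists 0, x; split=> //; [apply: ideal_zero|rewrite add0r]. Qed.

Lemma psum_sub X Y Z : is_ideal Z -> psub X Z -> psub Y Z -> psub (psum X Y) Z.
Proof. by move=> iZ h1 h2 _ [x [y [/h1 ? /h2 ? ->]]]; apply: ideal_add. Qed.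

Lemma psum_absorb X Y : is_ideal X -> is_ideal Y -> psub X Y -> psum X Y = Y.
Proof.
by move=> iX iY h; apply: psub_anti; [apply: psum_sub|apply: psub_psumr].
Qed.

(** The ideal X + Ra. Keeping a single explicit coefficient makes membership directly usable in
    computations modulo [X]. *)
Definition adj X a : pset R := fun z => exists r, X (z - r * a).

Lemma adj_ideal X a : is_ideal X -> is_ideal (adj X a).
Proof.
move=> iX; split.
- by exists 0; rewrite mul0r subr0; apply: ideal_zero.
- move=> x y [r h] [r' h']; exists (r + r').
  by apply: ideal_conv (ideal_add iX h h') _; ring.
- move=> r x [r' h]; exists (r * r').
  by apply: ideal_conv (ideal_mul r iX h) _; ring.
Qed.

Lemma sub_adj X a : psub X (adj X a).
Proof. by move=> x Xx; exists 0; rewrite mul0r subr0. Qed.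

Lemma adj_min X a K : is_ideal K -> psub X K -> K a -> psub (adj X a) K.
Proof.
move=> iK h Ka x [r /h Kx].
by apply: ideal_conv (ideal_add iK Kx (ideal_mul r iK Ka)) _; ring.
Qed.

Lemma mem_adj X a : is_ideal X -> adj X a a.
Proof. by move=> iX; exists 1; rewrite mul1r subrr; apply: ideal_zero. Qed.

Fixpoint adds X s : pset R := if s is a :: s' then adds (adj X a) s' else X.

Lemma adds_ideal X s : is_ideal X -> is_ideal (adds X s).
Proof. by elim: s X => [//|a s IH] X iX; apply/IH/adj_ideal. Qed.

Lemma sub_adds X s : psub X (adds X s).
Proof. by elim: s X => [|a s IH] X x Xx //; apply/IH/sub_adj. Qed.

Lemma adds_min X s K :
  is_ideal K -> psub X K -> (forall a, a \in s -> K a) -> psub (adds X s) K.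
Proof.
elim: s X => [|a s IH] X iK h hs //; apply: IH => //.
  by apply: adj_min => //; apply: hs; rewrite inE eqxx.
by move=> b bs; apply: hs; rewrite inE bs orbT.
Qed.

Lemma mem_adds X s a : is_ideal X -> a \in s -> adds X s a.
Proof.
elim: s X => [//|b s IH] X iX; rewrite inE => /orP[/eqP->|h] /=.
  by apply: sub_adds; apply: mem_adj.
by apply: IH => //; apply: adj_ideal.
Qed.

Lemma adds_mono X Y s : is_ideal Y -> psub X Y -> psub (adds X s) (adds Y s).
Proof.
move=> iY h; apply: adds_min; first exact: adds_ideal.
  by move=> x /h; apply: sub_adds.
by move=> a; apply: mem_adds.
Qed.

(** [adds] adjoins the head of the list first, that is innermost. Here it is moved outermost, where
    its coefficient can be split off. *)
Lemma adds_cons X a s : is_ideal X -> adds X (a :: s) = adj (adds X s) a.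
Proof.
move=> iX; apply: psub_anti.
  apply: adds_min; first by apply/adj_ideal/adds_ideal.
    by move=> x Xx; apply/sub_adj/sub_adds.
  move=> b; rewrite inE => /orP[/eqP->|h].
    by apply/mem_adj/adds_ideal.
  by apply/sub_adj/mem_adds.
apply: adj_min; first exact: adds_ideal.
  apply: adds_min; first exact: adds_ideal.
    by move=> x Xx; apply: sub_adds.
  by move=> b h; apply: mem_adds => //; rewrite inE h orbT.
by apply: mem_adds => //; rewrite inE eqxx.
Qed.

(** Replaces an intersection of ideals by explicit linear combinations. *)
Lemma gen_seqE s : gen_seq s = adds (@pzero R) s.
Proof.
apply: psub_anti.
  move=> x /(_ (adds (@pzero R) s)); apply.
    exact/adds_ideal/pzero_ideal.
  by move=> a /= h; apply: mem_adds => //; apply: pzero_ideal.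
move=> x hx J iJ h; apply: (adds_min _ _ _ hx) => // z ->; exact: ideal_zero.
Qed.

Lemma gen_by_ideal X : is_ideal (gen_by X).
Proof.
split.
- by move=> J iJ _; apply: ideal_zero.
- by move=> x y hx hy J iJ h; apply: ideal_add => //; [apply: hx|apply: hy].
- by move=> r x hx J iJ h; apply: ideal_mul => //; apply: hx.
Qed.

Lemma idprod_ideal X Y : is_ideal (idprod X Y).
Proof. exact: gen_by_ideal. Qed.

Lemma mem_idprod X Y x y : X x -> Y y -> idprod X Y (x * y).
Proof. by move=> hx hy J iJ; apply; exists x, y. Qed.

Lemma idprod_min X Y K :
  is_ideal K -> (forall x y, X x -> Y y -> K (x * y)) -> psub (idprod X Y) K.
Proof. by move=> iK h z; apply=> // _ [a [b [? ? ->]]]; apply: h. Qed.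

Lemma idprod_mono X X' Y Y' :
  psub X X' -> psub Y Y' -> psub (idprod X Y) (idprod X' Y').
Proof.
move=> hX hY; apply: idprod_min; first exact: idprod_ideal.
by move=> x y /hX hx /hY hy; apply: mem_idprod.
Qed.

Lemma idprod_subr X Y : is_ideal Y -> psub (idprod X Y) Y.
Proof. by move=> iY; apply: idprod_min => // x y _ Yy; apply: ideal_mul. Qed.

Lemma colon_ideal X Y : is_ideal X -> is_ideal (colon X Y).
Proof.
move=> iX; split.
- by move=> y _; rewrite mul0r; apply: ideal_zero.
- by move=> a b ha hb y Yy; rewrite mulrDl; apply: ideal_add => //; [apply: ha|apply: hb].
- by move=> r a ha y Yy; rewrite -mulrA; apply: ideal_mul => //; apply: ha.
Qed.

End Ideals.

(** * Krull's principal ideal theorem *)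

Section Noetherian.
Variable R : comNzRingType.
Hypothesis noeth : noetherian R.
Implicit Types (J X Y Z P Q M : pset R) (a b x y z : R).

(** The union of the chain is finitely generated, and all its generators already occur at one
    stage. *)
Lemma noeth_acc (F : nat -> pset R) :
  (forall i, is_ideal (F i)) -> (forall i, psub (F i) (F i.+1)) ->
  exists n, psub (F n.+1) (F n).
Proof.
move=> iF mF.
have mono i j : (i <= j)%N -> psub (F i) (F j).
  by move/subnK <-; elim: (j - i)%N => [//|k IH] x /IH; rewrite addSn; apply: mF.
pose U : pset R := fun x => exists i, F i x.
have iU : is_ideal U.
  split; first by exists 0%N; apply: ideal_zero.
    move=> x y [i hi] [j hj]; exists (maxn i j).
    by apply: ideal_add => //; [apply: (mono i)|apply: (mono j)] => //; lia.
  by move=> r x [i hi]; exists i; apply: ideal_mul.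
have [s hs] := noeth iU.
suff [n hn] : exists n, forall a, a \in s -> F n a.
  exists n => x hx; have : U x by exists n.+1.
  by move=> /hs; apply.
have: forall a, a \in s -> U a by move=> a sa; apply/hs => J iJ; apply.
elim: s {hs} => [|a s IH] h; first by exists 0%N.
have [|n hn] := IH; first by move=> b hb; apply: h; rewrite inE hb orbT.
have [|m hm] := h a; first by rewrite inE eqxx.
exists (maxn n m) => b; rewrite inE => /orP[/eqP->|/hn].
  by apply: (mono m) => //; lia.
by apply: (mono n); lia.
Qed.

(** Noetherian induction: from a counterexample, choice would build a strictly increasing sequence
    of ideals. *)
Lemma noeth_ind (Phi : pset R -> Prop) :
  (forall X, is_ideal X -> (forall Y, is_ideal Y -> pssub X Y -> Phi Y) -> Phi X) ->
  forall X, is_ideal X -> Phi X.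
Proof.
move=> step X iX; apply: NNPP => nX.
pose T := {Y : pset R | is_ideal Y /\ ~ Phi Y}.
have next (Y : T) : {Z : T | pssub (sval Y) (sval Z)}.
  apply: constructive_indefinite_description; apply: NNPP => h.
  case: Y h => Y [iY nY] /= h; apply: nY; apply: step => // Z iZ YZ.
  by apply: NNPP => nZ; apply: h; exists (exist _ Z (conj iZ nZ)).
pose F n := iter n (fun Y : T => sval (next Y)) (exist _ X (conj iX nX) : T).
have FS n : pssub (sval (F n)) (sval (F n.+1)) by rewrite /F iterS; case: (next _).
have [|i|n] := @noeth_acc (fun n => sval (F n)).
- by move=> i; case: (F i) => Y [].
- by case: (FS i).
by case: (FS n) => _ [x [h1 h2]] h3; apply: h2; apply: h3.
Qed.

Lemma noeth_max (Phi : pset R -> Prop) X :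
  is_ideal X -> Phi X -> exists Y, [/\ is_ideal Y, Phi Y, psub X Y &
    forall Z, is_ideal Z -> Phi Z -> psub Y Z -> psub Z Y].
Proof.
move=> iX; move: X iX; apply: noeth_ind => X iX IH pX.
case: (classic (exists Z, [/\ is_ideal Z, Phi Z & pssub X Z])).
  move=> [Z [iZ pZ XZ]]; have [Y [h1 h2 h3 h4]] := IH Z iZ XZ pZ.
  by exists Y; split => //; apply: psub_trans h3; case: XZ.
move=> h; exists X; split=> // Z iZ pZ XZ x Zx; apply: NNPP => nX.
by apply: h; exists Z; split=> //; split=> //; exists x.
Qed.

(* The contraction to R of the extension of Y to the localization of R at M. *)
Definition sat M Y : pset R := fun x => exists s, ~ M s /\ Y (s * x).

Lemma prime_nM M x y : prime_ideal M -> ~ M x -> ~ M y -> ~ M (x * y).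
Proof. by case=> _ _ h hx hy /h[]. Qed.

Lemma prime_n1 M : prime_ideal M -> ~ M 1.
Proof. by case. Qed.

Lemma prime_id M : prime_ideal M -> is_ideal M.
Proof. by case. Qed.

Lemma sat_ideal M Y : prime_ideal M -> is_ideal Y -> is_ideal (sat M Y).
Proof.
move=> pM iY; split.
- by exists 1; split; [apply: prime_n1|rewrite mulr0; apply: ideal_zero].
- move=> x y [s [hs h]] [t [ht h']]; exists (s * t); split; first exact: prime_nM.
  by apply: ideal_conv (ideal_add iY (ideal_mul t iY h) (ideal_mul s iY h')) _; ring.
- move=> r x [s [hs h]]; exists s; split=> //.
  by apply: ideal_conv (ideal_mul r iY h) _; ring.
Qed.

Lemma sub_sat M Y : prime_ideal M -> psub Y (sat M Y).
Proof. by move=> pM x Yx; exists 1; split; [apply: prime_n1|rewrite mul1r]. Qed.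

Lemma sat_sub M X Y : prime_ideal M -> psub X (sat M Y) -> psub (sat M X) (sat M Y).
Proof.
move=> pM h x [s [hs /h [t [ht Yt]]]]; exists (t * s); split; first exact: prime_nM.
by rewrite -mulrA.
Qed.

Lemma sat_mono M X Y : prime_ideal M -> psub X Y -> psub (sat M X) (sat M Y).
Proof. by move=> pM h; apply: sat_sub => // x /h; apply: sub_sat. Qed.

(** Nakayama's lemma over the localization at [M], stated in [R] itself. The generators of [Z] are
    discarded one at a time: up to a factor outside [M], each is a combination of the remaining ones
    modulo [Y]. *)
Lemma nakayama_sat M Y Z : prime_ideal M -> is_ideal Y -> is_ideal Z ->
  psub Z (sat M (psum Y (idprod M Z))) -> psub Z (sat M Y).
Proof.
move=> pM iY iZ hZ; have iM := prime_id pM; have [s hs] := noeth iZ.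
have: psub Z (sat M (adds Y s)).
  move=> x /hs; rewrite gen_seqE => h; apply: sub_sat => //.
  by apply: adds_mono h => // z ->; apply: ideal_zero.
have: forall a, a \in s -> Z a by move=> a sa; apply/hs => J iJ; apply.
elim: s {hs} => [//|a s IH] sZ h.
have iYs := adds_ideal s iY.
have sZ' b : b \in s -> Z b by move=> hb; apply: sZ; rewrite inE hb orbT.
apply: IH => //.
apply: (@psub_trans _ (sat M (adds Y (a :: s)))) => //; apply: sat_sub => //.
apply: adds_min; first exact: sat_ideal.
  by move=> x Yx; apply: sub_sat => //; apply: sub_adds.
move=> b; rewrite inE => /orP[/eqP->{b}|hb]; last first.
  by apply: sub_sat => //; apply: mem_adds.
have [|s0 [hs0 [y0 [u [Yy0 hu e]]]]] := hZ a.
  by apply: sZ; rewrite inE eqxx.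
(* After a factor outside [M], an element of MZ is a multiple [m * a] with [m] in [M], modulo [Y]
   and the remaining generators. *)
have: exists s1 m, [/\ ~ M s1, M m & adds Y s (s1 * u - m * a)].
  pose K : pset R := fun u => exists s1 m, [/\ ~ M s1, M m & adds Y s (s1 * u - m * a)].
  have iK : is_ideal K.
    split.
    - exists 1, 0; split; [exact: prime_n1|exact: ideal_zero|].
      by rewrite mulr0 mul0r subrr; apply: ideal_zero.
    - move=> x y [s1 [m1 [h1 h2 h3]]] [s2 [m2 [h4 h5 h6]]].
      exists (s1 * s2), (s2 * m1 + s1 * m2); split; first exact: prime_nM.
        by apply: ideal_add => //; apply: ideal_mul.
      by apply: ideal_conv (ideal_add iYs (ideal_mul s2 iYs h3) (ideal_mul s1 iYs h6)) _; ring.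
    - move=> r x [s1 [m1 [h1 h2 h3]]]; exists s1, (r * m1); split=> //.
        by apply: ideal_mul.
      by apply: ideal_conv (ideal_mul r iYs h3) _; ring.
  suff KMZ : psub (idprod M Z) K by exact: KMZ.
  apply: idprod_min => // m w Mm /h [s1 [hs1]].
  rewrite adds_cons // => -[r hr]; exists s1, (m * r); split=> //.
    by apply: ideal_mulr.
  by apply: ideal_conv (ideal_mul m iYs hr) _; ring.
(* This factor is outside [M] because [s1 * s0] is outside and [m] inside. *)
move=> [s1 [m [hs1 Mm hm]]]; exists (s1 * s0 - m); split.
  have := prime_nM pM hs1 hs0 => h1 h2; apply: h1.
  by apply: ideal_conv (ideal_add (prime_id pM) h2 Mm) _; ring.
have h1 : adds Y s (s1 * y0) by apply: sub_adds; apply: ideal_mul.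
apply: ideal_conv (ideal_add iYs h1 hm) _.
rewrite mulrBl -[s1 * s0 * a]mulrA e; ring.
Qed.

(* A maximal member of the family of ideals (X : y), with y outside X, is prime,
   and it lies between J and M because X is saturated. *)
Lemma assoc_minimal M J X : prime_ideal M -> is_ideal X -> psub J X ->
  (forall P, prime_ideal P -> psub J P -> psub P M -> psub M P) ->
  psub (sat M X) X -> ~ X 1 ->
  exists y, ~ X y /\ forall m, M m -> X (m * y).
Proof.
move=> pM iX JX minM sX nX.
pose Phi Y := exists y, ~ X y /\ Y = (fun z => X (z * y)).
have iPhi y : is_ideal (fun z => X (z * y)).
  split; first by rewrite mul0r; apply: ideal_zero.
    by move=> a b ha hb; rewrite mulrDl; apply: ideal_add.
  by move=> r a ha; rewrite -mulrA; apply: ideal_mul.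
have [|Y [iY [y [ny eY]] _ maxY]] := @noeth_max Phi X iX.
  by exists 1; split=> //; apply: peq_eq => x; rewrite mulr1.
exists y; split=> // m Mm.
suff: psub M Y by move=> /(_ _ Mm); rewrite eY.
apply: minM; last first.
- rewrite eY => z hz; apply: NNPP => nM; apply: ny; apply: sX; by exists z.
- by move=> z /JX Xz; rewrite eY; apply: ideal_mulr.
split=> //; first by rewrite eY mul1r.
move=> a b hab; case: (classic (Y b)) => hb; first by right.
left; have nby : ~ X (b * y) by move: hb; rewrite eY.
have := maxY _ (iPhi (b * y)); apply.
- by exists (b * y).
- by rewrite eY => z hz; rewrite mulrCA; apply: ideal_mul.
by move: hab; rewrite eY mulrA.
Qed.

(** Since [M] is minimal over [J], the localization of R/J at [M] is artinian. The proof is a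
    Noetherian induction on a saturated [X] below the whole chain: the element [y] from
    [assoc_minimal] spans a simple module modulo [X] after localization, and [Y] is the saturation
    of X + (y). *)
Lemma dcc_minimal M J : prime_ideal M -> is_ideal J ->
  (forall P, prime_ideal P -> psub J P -> psub P M -> psub M P) ->
  forall I : nat -> pset R, (forall i, is_ideal (I i)) ->
  (forall i, psub (I i.+1) (I i)) -> (forall i, psub (sat M (I i)) (I i)) ->
  (forall i, psub J (I i)) ->
  exists n, forall m, (n <= m)%N -> psub (I n) (I m).
Proof.
move=> pM iJ minM.
pose Phi X := psub J X -> psub (sat M X) X ->
  forall I : nat -> pset R, (forall i, is_ideal (I i)) ->
  (forall i, psub (I i.+1) (I i)) -> (forall i, psub (sat M (I i)) (I i)) ->
  (forall i, psub X (I i)) ->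
  exists n, forall m, (n <= m)%N -> psub (I n) (I m).
suff H X : is_ideal X -> Phi X.
  move=> I iI dI sI JI.
  apply: (H (sat M J)) => //; first exact: sat_ideal.
  - exact: sub_sat.
  - exact: sat_sub.
  - by move=> i x /(sat_mono pM (JI i)); apply: sI.
move: X; apply: noeth_ind => X iX IH JX sX I iI dI sI XI.
have mI i j : (i <= j)%N -> psub (I j) (I i).
  by move/subnK <-; elim: (j - i)%N => [//|k IHk] x; rewrite addSn => /dI /IHk.
case: (classic (X 1)) => [X1|nX].
  exists 0%N => m _ x _; apply: XI; rewrite -[x]mulr1; exact: ideal_mul.
have [y [ny My]] := assoc_minimal pM iX JX minM sX nX.
pose Y := sat M (adj X y).
have iY : is_ideal Y by apply: sat_ideal => //; apply: adj_ideal.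
have XY : psub X Y by move=> x Xx; apply: sub_sat => //; apply: sub_adj.
have Yy : Y y by apply: sub_sat => //; apply: mem_adj.
have {}IH : Phi Y by apply: IH => //; split=> //; exists y.
have JY : psub J Y by apply: psub_trans XY.
have sY : psub (sat M Y) Y by apply: sat_sub.
case: (classic (forall i, I i y)) => [Iy|].
  apply: (IH JY sY I) => // i; apply: psub_trans (sI i).
  by apply: sat_mono => //; apply: adj_min.
move=> /not_all_ex_not [n0 hn0].
(* Because Y/X is simple after localization, a member of the chain that misses [y] meets [Y] only
   inside [X]. *)
have smp i z : (n0 <= i)%N -> I i z -> Y z -> X z.
  move=> hi Iz [s [hs [r hr]]]; apply: NNPP => nXz.
  case: (classic (M r)) => Mr.
    apply: nXz; apply: sX; exists s; split=> //.
    by apply: ideal_conv (ideal_add iX hr (My r Mr)) _; ring.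
  apply: hn0; apply: (mI _ _ hi); apply: sI; exists r; split=> //.
  by apply: ideal_conv (ideal_sub (iI i) (ideal_mul s (iI i) Iz) (XI i _ hr)) _; ring.
(* By induction the saturated sums with [Y] become stationary; the modular law and [smp] carry this
   back to the chain itself. *)
have [||||n hn] := IH JY sY (fun i => sat M (psum (I i) Y)).
- by move=> i; apply: sat_ideal => //; apply: psum_ideal.
- move=> i; apply: sat_mono => // _ [a [b [ha hb ->]]]; exists a, b; split=> //.
  exact: dI.
- by move=> i; apply: sat_sub.
- by move=> i x hx; apply: sub_sat => //; apply: psub_psumr hx.
exists (maxn n n0) => m hm z Iz.
have Inz : I n z by apply: mI Iz; lia.
have hnm : (n <= m)%N by lia.
have [|s [hs [a [b [ha hb e]]]]] := hn m hnm z.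
  by apply: sub_sat => //; apply: psub_psuml.
apply: sI; exists s; split=> //; rewrite e; apply: ideal_add => //; apply: XI.
apply: (@smp (maxn n n0)) => //; first by lia.
have := mI _ _ hm _ ha => ha'.
by apply: ideal_conv (ideal_sub (iI _) (ideal_mul s (iI _) Iz) ha') _; rewrite e; ring.
Qed.

(* Krull's principal ideal theorem in R/P localized at M. The descending chain
   Q^(n) + (a) of symbolic powers is stationary, so Nakayama twice gives
   Q^n contained in P. *)
Lemma principal_ideal_thm P Q M a :
  prime_ideal P -> prime_ideal Q -> prime_ideal M -> pssub P Q -> pssub Q M -> M a ->
  exists P', [/\ prime_ideal P', psub P P', P' a & pssub P' M].
Proof.
move=> pP pQ pM [PQ [q [Qq nPq]]] [QM [q' [Mq' nQq']]] Ma.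
have iP := prime_id pP; have iQ := prime_id pQ; have iM := prime_id pM.
case: (classic (Q a)) => [Qa|nQa].
  by exists Q; split=> //; split=> //; exists q'.
(* If there is no such prime, [M] is minimal over P + (a), and [dcc_minimal] applies. *)
apply: NNPP => none.
pose J := adj P a; have iJ : is_ideal J by apply: adj_ideal.
have minM P' : prime_ideal P' -> psub J P' -> psub P' M -> psub M P'.
  move=> pP' JP' P'M x Mx; apply: NNPP => nx; apply: none; exists P'; split=> //.
  - by move=> z Pz; apply: JP'; apply: sub_adj.
  - by apply: JP'; apply: mem_adj.
  - by split=> //; exists x.
pose Qp n := iter n (idprod Q) (@pfull R).
have iQp n : is_ideal (Qp n) by case: n => [//|n]; apply: idprod_ideal.
pose E n := psum (Qp n) P.
have iE n : is_ideal (E n) by apply: psum_ideal.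
pose S n := sat Q (E n); have iS n : is_ideal (S n) by apply: sat_ideal.
have ES n : psub (E n.+1) (E n).
  move=> _ [x [y [hx hy ->]]]; exists x, y; split=> //; exact: idprod_subr hx.
have SS n : psub (S n.+1) (S n) by apply: sat_mono.
(* Multipliers outside [M] are also outside [Q], so the symbolic powers are saturated at [M] too. *)
have satMQ n : psub (sat M (S n)) (S n).
  move=> x [s [hs Sx]]; have h : psub (sat Q (S n)) (S n) by apply: sat_sub.
  apply: h.
  by exists s; split=> // Qs; apply/hs/QM.
have iA n : is_ideal (adj (S n) a) by apply: adj_ideal.
have [||||n hn] := dcc_minimal (M := M) pM iJ minM (I := fun n => sat M (adj (S n) a)).
- by move=> i; apply: sat_ideal.
- move=> i; apply: sat_mono => //; apply: adj_min => //; last exact: mem_adj.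
  by move=> x /SS; apply: sub_adj.
- by move=> i; apply: sat_sub.
- move=> i; apply: psub_trans (sub_sat _) => //; apply: adj_min => //.
    move=> x Px; apply: sub_adj; apply: sub_sat => //; exact: psub_psumr.
  exact: mem_adj.
have {hn} SSn : psub (S n) (S n.+1).
  apply: psub_trans (satMQ _); apply: nakayama_sat => // x Sx.
  have [|s [hs [r hr]]] := hn n.+1 (leqnSn n) x.
    by apply: sub_sat => //; apply: sub_adj.
  exists s; split=> //; exists (s * x - r * a), (a * r); split=> //; last by ring.
  (* Here [r] lies in [S n]: the product [r * a] does, and [a], being outside [Q], can be
     cancelled. *)
  apply: mem_idprod => //.
  have [t [ht Et]] : S n (r * a).
    by apply: ideal_conv (ideal_sub (iS n) (ideal_mul s (iS n) Sx) (SS _ _ hr)) _; ring.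
  exists (t * a); split; first exact: prime_nM.
  by apply: ideal_conv Et _; ring.
(* The second use of Nakayama is at [Q]: the equality of two successive symbolic powers puts Q^n
   into P + Q Q^n after localization. *)
have QnP : psub (Qp n) (sat Q P).
  apply: nakayama_sat => // x hx.
  have: S n.+1 x.
    by apply: SSn; apply: sub_sat => //; apply: psub_psuml hx.
  apply: sat_mono => // _ [u [v [hu hv ->]]]; rewrite addrC; by exists v, u.
have {QnP} : psub (Qp n) P.
  move=> x /QnP [s [hs]]; case: pP => _ _ h /h [] // /PQ //.
have pw x : Q x -> Qp n (x ^+ n).
  by move=> Qx; elim: n {SSn} => [//|n IH]; rewrite exprS; apply: mem_idprod.
move=> h; have {h} := h _ (pw _ Qq).
elim: n {SSn pw} => [|n IH]; first by rewrite expr0; case: pP.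
by rewrite exprS; case: pP => _ _ h /h[].
Qed.

End Noetherian.

(** * Rerouting chains of primes through a given element *)

Section Height.
Variable R : comNzRingType.
Hypothesis noeth : noetherian R.

(** Working downwards from the top, [principal_ideal_thm] replaces one intermediate prime at a time
    by a prime containing [a], without changing the bottom or the length. *)
Lemma chain_through (d : nat) (P : nat -> pset R) (a : R) :
  prime_chain P d.+1 -> P d.+1 a ->
  exists P', [/\ prime_chain P' d.+1, P' 0%N = P 0%N & P' 1%N a].
Proof.
suff H j (P' : nat -> pset R) : (j <= d)%N -> prime_chain P' d.+1 -> P' j.+1 a ->
    exists P'', [/\ prime_chain P'' d.+1, P'' 0%N = P' 0%N & P'' 1%N a].
  by move=> cP Pa; apply: (H d).
elim: j P' => [|j IH] P' hj cP Pa; first by exists P'.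
case: (classic (P' j a)) => [Pja|nPja].
  by apply: IH => //; [lia|case: cP => _ /(_ j ltac:(lia)) [h _]; apply: h].
case: (cP) => pP sP.
have [||||||Q [pQ PQ Qa QP]] := @principal_ideal_thm _ noeth (P' j) (P' j.+1) (P' j.+2) a.
1-6: by (apply: pP; lia) || (apply: sP; lia) || done.
pose P2 i := if i == j.+1 then Q else P' i.
have [|||P3 [h1 h2 h3]] := IH P2; last by exists P3; split.
- by lia.
- split=> i hi; rewrite /P2; first by case: eqP => // _; apply: pP.
  case: eqP => [e|ne]; case: eqP => [e'|ne'].
  + by lia.
  + by rewrite e.
  + have -> : i = j by lia.
    by split=> //; exists a.
  + by apply: sP; lia.
- by rewrite /P2 eqxx.
Qed.

End Height.

(** * Local rings, powers of the maximal ideal, and Krull's height theorem *)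

Section Local.
Variable R : comNzRingType.
Hypothesis noeth : noetherian R.
Hypothesis loc : local_ring R.
Implicit Types (I J K X Y Z D P : pset R) (s t : seq R).
Local Notation n := (@nonunit R).

Lemma nonunit_id : is_ideal n. Proof. exact: loc. Qed.
Hint Resolve nonunit_id : core.

Lemma nonunit_n1 : ~ n 1.
Proof. by apply; exists 1; rewrite mulr1. Qed.

Lemma unit_of u : ~ n u -> exists v, u * v = 1.
Proof. exact: NNPP. Qed.

Lemma unit_cancel I u x : is_ideal I -> ~ n u -> I (u * x) -> I x.
Proof.
move=> iI /unit_of [v uv] h; apply: ideal_conv (ideal_mul v iI h) _.
by rewrite mulrA [v * u]mulrC uv mul1r.
Qed.

Lemma nonunit_prime : prime_ideal n.
Proof.
split=> //; first exact: nonunit_n1.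
move=> a b hab; case: (classic (n a)) => ha; [by left|right].
exact: unit_cancel hab.
Qed.

Lemma nakayama Y Z : is_ideal Y -> is_ideal Z ->
  psub Z (psum Y (idprod n Z)) -> psub Z Y.
Proof.
move=> iY iZ h z Zz.
have [|u [hu]] := nakayama_sat noeth nonunit_prime iY iZ _ Zz.
  by apply: psub_trans h _; apply: sub_sat; exact: nonunit_prime.
exact: unit_cancel.
Qed.

Lemma prime_sub_nonunit P : prime_ideal P -> psub P n.
Proof.
by move=> [iP nP _] x Px [y xy]; apply: nP; exact: ideal_conv (ideal_mulr y iP Px) xy.
Qed.

Lemma nonunit_sub I : is_ideal I -> ~ I 1 -> psub I n.
Proof. by move=> iI nI x Ix [y xy]; apply: nI; apply: ideal_conv (ideal_mulr y iI Ix) xy. Qed.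

(* The exponent is shifted: npow k is n^(k+1). *)
Definition npow k : pset R := iter k (idprod n) n.

Lemma npow_ideal k : is_ideal (npow k).
Proof. by case: k => [//|k]; apply: idprod_ideal. Qed.
Hint Resolve npow_ideal : core.

Lemma npowS k : psub (npow k.+1) (npow k).
Proof. exact: idprod_subr. Qed.

Lemma npow_exp k x : n x -> npow k (x ^+ k.+1).
Proof.
move=> nx; elim: k => [|k IH]; first by rewrite expr1.
by rewrite exprS; apply: mem_idprod.
Qed.

(** Induction on [s]: [chain_through] puts the head of [s] into the prime just above the bottom one;
    then the bottom prime is dropped, which shortens both the chain and the list by one. *)
Lemma krull_height s (P : nat -> pset R) d k :
  prime_chain P d -> (forall a, a \in s -> n a) ->
  psub (npow k) (adds (P 0%N) s) -> (d <= size s)%N.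
Proof.
elim: s P d => [|a s IH] P [//|d] [pP sP] hs h /=.
  have [h1 [x [P1x nP0x]]] := sP 0%N isT.
  have [_ _ pr] := pP 0%N isT; case: nP0x.
  (* With no generators left, a power of [x] lies in the bottom prime, hence so does [x]. *)
  have: P 0%N (x ^+ k.+1).
    by apply/h/npow_exp/(prime_sub_nonunit (pP 1%N isT)).
  elim: k.+1 => [|i IHi]; last by rewrite exprS => /pr [].
  by rewrite expr0; case: (pP 0%N isT).
(* The top prime is enlarged to the maximal ideal so that it contains [a]. *)
pose P' i := if i == d.+1 then n else P i.
have cP' : prime_chain P' d.+1.
  split=> i hi; rewrite /P'.
    by case: eqP => // _; [exact: nonunit_prime|exact: pP].
  case: eqP => [e|_]; first by lia.
  have [h1 [x [h2 h3]]] := sP i hi.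
  case: eqP => [e|_]; last exact: sP.
  have hn := prime_sub_nonunit (pP i.+1 hi).
  by split; [apply: psub_trans hn|exists x; split=> //; apply: hn].
have [|P2 [[pP2 sP2] e0 h1]] := chain_through noeth cP' (a := a).
  by rewrite /P' eqxx; apply: hs; rewrite inE eqxx.
rewrite ltnS; apply: (IH (fun i => P2 i.+1)).
- by split=> i hi; [apply: pP2|apply: sP2].
- by move=> b hb; apply: hs; rewrite inE hb orbT.
have [iP1 _ _] := pP2 1%N isT.
apply: psub_trans h _ => /=; apply: adds_mono => //; apply: adj_min => //.
by move=> x hx; case: (sP2 0%N isT) => + _; apply; rewrite e0 /P' /=.
Qed.

End Local.

(** * Length *)

Section Length.
Variable R : comNzRingType.
Implicit Types (X Y Z D E : pset R).

(** Composition series built by adding steps at the top, an inductive form of [ideal_length]. *)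
Inductive len X : pset R -> nat -> Prop :=
| len0 : is_ideal X -> len X X 0
| lenS Y Z k : len X Y k -> is_ideal Z -> comp_step Y Z -> len X Z k.+1.

Lemma len_id X Y k : len X Y k -> [/\ is_ideal X, is_ideal Y & psub X Y].
Proof.
elim=> [//|Y' Z j _ [iX iY XY] iZ [[YZ _] _]]; split=> //.
exact: psub_trans YZ.
Qed.

Lemma lenP X Y k : len X Y k <-> ideal_length X Y k.
Proof.
split.
  elim=> [iX|Y' Z j _ [C [/peq_eq e0 /peq_eq ej iC sC]] iZ st].
    by exists (fun _ => X); split.
  exists (fun i => if (i <= j)%N then C i else Z).
  split.
  - by rewrite leq0n e0.
  - by rewrite ltnn.
  - by move=> i _; case: leqP => // h; apply: iC.
  - move=> i hi; have -> : (i <= j)%N by lia.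
    case: leqP => h; last by apply: sC.
    have e : i = j by lia.
    by rewrite e ej.
move=> [C [/peq_eq <- /peq_eq <- iC sC]].
elim: k iC sC => [|k IH] iC sC; first by apply: len0; apply: iC.
apply: (lenS (Y := C k)); [apply: IH|exact: iC|exact: sC].
  by move=> i hi; apply: iC; lia.
by move=> i hi; apply: sC; lia.
Qed.

(** The hypothesis on Y and D makes (Y + D)/(X + D) isomorphic to Y/X; an intermediate [C] is
    compared with its intersection with [Y]. *)
Lemma comp_step_psum X Y D : is_ideal X -> is_ideal Y -> is_ideal D ->
  psub (pcap Y D) X -> comp_step X Y -> comp_step (psum X D) (psum Y D).
Proof.
move=> iX iY iD h [[XY [y [Yy nXy]]] simple].
have iXD : is_ideal (psum X D) by apply: psum_ideal.
split; first split.
- by move=> _ [a [b [ha hb ->]]]; exists a, b; split=> //; apply: XY.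
- exists y; split; first exact: psub_psuml.
  move=> [a [b [ha hb e]]]; apply: nXy; rewrite e; apply: ideal_add => //.
  apply: h; split=> //; apply: ideal_conv (ideal_sub iY Yy (XY _ ha)) _.
  by rewrite e; ring.
- move=> C iC XC CY.
  have XcC : psub X (pcap C Y).
    by move=> x Xx; split; [apply/XC/psub_psuml|apply: XY].
  have [h1|h1] := simple _ (pcap_ideal iC iY) XcC (fun x => @proj2 _ _).
    left => c Cc; have [a [b [ha hb e]]] := CY _ Cc; rewrite e.
    apply: ideal_add => //; last exact: psub_psumr.
    apply: psub_psuml => //; apply: h1; split=> //.
    have Cb : C b by apply: XC; apply: psub_psumr.
    by apply: ideal_conv (ideal_sub iC Cc Cb) _; rewrite e; ring.
  right; apply: psum_sub => //; first by move=> z /h1 [].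
  by move=> z Dz; apply: XC; apply: psub_psumr.
Qed.

Lemma len_psum X Y k D : len X Y k -> is_ideal D -> psub (pcap Y D) X ->
  len (psum X D) (psum Y D) k.
Proof.
move=> + iD; elim=> [iX _|Y' Z j l IH iZ st h].
  by apply: len0; apply: psum_ideal.
have [iX iY XY] := len_id l; case: (st) => -[YZ _] _.
apply: (lenS (Y := psum Y' D)).
- by apply: IH => z [/YZ hz Dz]; apply: h.
- exact: psum_ideal.
- by apply: comp_step_psum => // z /h /XY.
Qed.

Lemma psumC X Y : psum X Y = psum Y X.
Proof. by apply: peq_eq => z; split=> -[a [b [? ? ->]]]; exists b, a; rewrite addrC. Qed.

(** Induction on the top step from [Y] to Z. Either [D] lies in [Y], or Y + D = Z; then D modulo its
    intersection with [Y] is simple, and Z/D is isomorphic to Y modulo that intersection. *)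
Lemma len_split X Z k D : len X Z k -> is_ideal D -> psub X D -> psub D Z ->
  exists p q, [/\ len X D p, len D Z q & (p + q)%N = k].
Proof.
move=> l; elim: l D => [iX|Y Z' j l IH iZ st] D iD XD DZ.
  have -> : D = X by apply: psub_anti.
  by exists 0%N, 0%N; split=> //; apply: len0.
have [iX iY XY] := len_id l; case: (st) => -[YZ nYZ] simple.
case: (classic (psub D Y)) => [DY|nDY].
  have [p [q [h1 h2 h3]]] := IH D iD XD DY.
  by exists p, q.+1; split=> //; [apply: lenS st|lia].
have iD' : is_ideal (pcap D Y) by apply: pcap_ideal.
have [||p [q [h1 h2 h3]]] := IH (pcap D Y) iD'.
- by move=> x Xx; split; [apply: XD|apply: XY].
- by move=> x [].
have YDZ : psum Y D = Z'.
  have [|||h|h] := simple (psum Y D).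
  - exact: psum_ideal.
  - exact: psub_psuml.
  - exact: psum_sub.
  - by case: nDY => d Dd; apply: h; apply: psub_psumr.
  - by apply: psub_anti => //; apply: psum_sub.
exists p.+1, q; split; last by lia.
  apply: (lenS h1) => //; split.
    split; first by move=> x [].
    by have [x [Dx nY]] := not_psub nDY; exists x; split=> // -[].
  move=> C iC DC CD.
  have [|||h|h] := simple (psum C Y).
  - exact: psum_ideal.
  - exact: psub_psumr.
  - by apply: psum_sub => // x /CD /DZ.
  - by left=> c Cc; split; [apply: CD|apply: h; apply: psub_psuml].
  right=> d Dd; have [c [y [Cc Yy e]]] := h _ (DZ _ Dd).
  rewrite e; apply: ideal_add => //; apply: DC; split=> //.
  by apply: ideal_conv (ideal_sub iD Dd (CD _ Cc)) _; rewrite e; ring.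
have := len_psum h2 iD; rewrite YDZ psum_absorb //; last by move=> x [].
by apply=> x [].
Qed.

Lemma comp_step_len X Y k : is_ideal X -> comp_step X Y -> len X Y k -> k = 1%N.
Proof.
move=> iX [[XY [y [Yy nXy]]] simple] l.
case: l Yy simple => [//|Y' Z j l iZ [[YZ [z [Zz nYz]]] _]] _ simple.
have [_ iY XY'] := len_id l.
have [h|h] := simple Y' iY XY' YZ; last by case: nYz; apply: h.
case: l h nYz => [//|Y2 Z2 i l2 iZ2 [[h1 [w [h2 h3]]] _]] h _.
by case: h3; have [_ _] := len_id l2; apply; apply: h.
Qed.

Lemma len_refl_eq0 X Y k : len X Y k -> Y = X -> k = 0%N.
Proof.
case=> [//|Y' Z i l iZ [[YZ [z [Zz nYz]]] _]] e.
have [_ _ XY'] := len_id l; case: nYz; apply: XY'; by rewrite -e.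
Qed.

(** The Jordan-Hölder theorem for lengths: the second series is split at the penultimate term of the
    first. *)
Lemma len_uniq X Y j k : len X Y j -> len X Y k -> j = k.
Proof.
move=> l; elim: l k => [iX|Y' Z i l IH iZ st] k l'.
  by rewrite (len_refl_eq0 l').
have [iX iY XY] := len_id l; case: (st) => -[YZ _] _.
have [p [q [h1 h2 <-]]] := len_split l' iY XY YZ.
by rewrite (IH _ h1) (comp_step_len iY st h2); lia.
Qed.

Lemma len_sub_le X Y D E j k : len X Y k -> len D E j -> psub X D -> psub E Y ->
  (j <= k)%N.
Proof.
move=> l l' XD EY; have [iD iE DE] := len_id l'.
have [p [q [_ h2 <-]]] := len_split l iD XD (psub_trans DE EY).
have [r [u [h3 _ <-]]] := len_split h2 iE DE EY.
by rewrite (len_uniq l' h3); lia.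
Qed.

Lemma len_zero X Y : len X Y 0 -> X = Y.
Proof. by move=> l; inversion l. Qed.

Lemma len_eq X Y D k : len X Y k -> len X D k -> psub D Y -> D = Y.
Proof.
move=> l l' DY; have [_ iD XD] := len_id l'.
have [p [q [h1 h2 e]]] := len_split l iD XD DY.
have q0 : q = 0%N by have := len_uniq h1 l'; lia.
by apply: len_zero; rewrite q0 in h2.
Qed.

Lemma len_basis X Y k : len X Y k -> exists s, size s = k /\ Y = adds X s.
Proof.
elim=> [_|Y' Z j l [s [<- ->]] iZ st]; first by exists [::].
have [iX _ _] := len_id l; have iA := adds_ideal s iX.
case: st => -[YZ [z [Zz nYz]]] simple.
exists (z :: s); split=> //; rewrite adds_cons //; apply: psub_anti.
  have [|||h|//] := simple (adj (adds X s) z).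
  - exact: adj_ideal.
  - exact: sub_adj.
  - exact: adj_min.
  - by case: nYz; apply: h; apply: mem_adj.
exact: adj_min.
Qed.

(** When the maximal ideal multiplies [s] into [X], this is linear independence modulo [X] over the
    residue field. *)
Fixpoint indep X (s : seq R) : Prop :=
  if s is a :: s' then ~ X a /\ indep (adj X a) s' else True.

(** * Length as dimension over the residue field, and minimal numbers of generators *)

Section LocalLength.
Hypothesis loc : local_ring R.
Local Notation n := (@nonunit R).

Lemma comp_step_adj X a : is_ideal X -> (forall m, n m -> X (m * a)) -> ~ X a ->
  comp_step X (adj X a).
Proof.
move=> iX ha nXa; split.
  by split; [apply: sub_adj|exists a; split=> //; apply: mem_adj].
move=> C iC XC CA; case: (classic (psub C X)) => [|/not_psub]; first by left.
move=> [c [Cc nXc]]; right; apply: adj_min => //.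
have [r hr] := CA _ Cc.
have ur : ~ n r.
  move=> nr; apply: nXc; apply: ideal_conv (ideal_add iX hr (ha _ nr)) _; ring.
apply: (unit_cancel iC ur).
by apply: ideal_conv (ideal_sub iC Cc (XC _ hr)) _; ring.
Qed.

Lemma len_prepend X Y Z k : is_ideal X -> comp_step X Y -> len Y Z k -> len X Z k.+1.
Proof.
move=> iX st; elim=> [iY|Y' Z' j l IH iZ st'].
  by apply: lenS st => //; apply: len0.
exact: lenS st'.
Qed.

Lemma len_adds_le X s : is_ideal X -> (forall a m, a \in s -> n m -> X (m * a)) ->
  exists k, (k <= size s)%N /\ len X (adds X s) k.
Proof.
elim: s X => [|a s IH] X iX h; first by exists 0%N; split=> //; apply: len0.
have [||k [hk lk]] := IH (adj X a).
- exact: adj_ideal.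
- by move=> b m hb nm; apply/sub_adj/h => //; rewrite inE hb orbT.
case: (classic (X a)) => Xa.
  have eX : adj X a = X by apply: psub_anti; [apply: adj_min|apply: sub_adj].
  by rewrite eX in lk; exists k; split; [apply: leqW|rewrite /= eX].
exists k.+1; split=> //; apply: len_prepend lk => //.
by apply: comp_step_adj => // m nm; apply: h => //; rewrite inE eqxx.
Qed.

Lemma len_indep X s : is_ideal X -> (forall a m, a \in s -> n m -> X (m * a)) ->
  indep X s -> len X (adds X s) (size s).
Proof.
elim: s X => [|a s IH] X iX h /=; first by move=> _; apply: len0.
move=> [Xa ind]; apply: (len_prepend (Y := adj X a)) => //.
  by apply: comp_step_adj => // m nm; apply: h => //; rewrite inE eqxx.
apply: IH => //; first exact: adj_ideal.
by move=> b m hb nm; apply/sub_adj/h => //; rewrite inE hb orbT.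
Qed.

Lemma len_gen_le X s k : (forall a m, a \in s -> n m -> X (m * a)) ->
  len X (adds X s) k -> (k <= size s)%N.
Proof.
move=> h l; have [iX _ _] := len_id l; have [j [hj lj]] := len_adds_le iX h.
by rewrite (len_uniq l lj).
Qed.

Lemma len_indep_le X Y s k : len X Y k -> (forall a, a \in s -> Y a) ->
  (forall a m, a \in s -> n m -> X (m * a)) -> indep X s -> (size s <= k)%N.
Proof.
move=> l sY h ind; have [iX iY XY] := len_id l.
by apply: (len_sub_le l (len_indep iX h ind)) => //; apply: adds_min.
Qed.

Lemma len_indep_full X Y s k : len X Y k -> (forall a, a \in s -> Y a) ->
  (forall a m, a \in s -> n m -> X (m * a)) -> indep X s -> size s = k ->
  adds X s = Y.
Proof.
move=> l sY h ind e; have [iX iY XY] := len_id l.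
apply: (len_eq l); last exact: adds_min.
by rewrite -e; apply: len_indep.
Qed.

(** If [m * y] were outside [X], it would generate Y/X, so (1 - rm)y would lie in [X] for some r,
    although 1 - rm is a unit. *)
Lemma comp_step_kill X Y m y : is_ideal X -> is_ideal Y -> comp_step X Y ->
  n m -> Y y -> X (m * y).
Proof.
move=> iX iY [[XY _] simple] nm Yy; apply: NNPP => nX.
have [|||h|h] := simple (adj X (m * y)).
- exact: adj_ideal.
- exact: sub_adj.
- by apply: adj_min => //; apply: ideal_mul.
- by apply/nX/h/mem_adj.
have [r hr] := h _ Yy; apply: nX; apply: ideal_mul => //.
apply: (unit_cancel (u := 1 - r * m)) => //.
  move=> h1; apply: (nonunit_n1 (R := R)).
  by apply: ideal_conv (ideal_add loc h1 (ideal_mul r loc nm)) _; ring.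
by apply: ideal_conv hr _; ring.
Qed.

Lemma len1_step X Y : len X Y 1 -> comp_step X Y.
Proof.
move E: 1%N => k l; case: l E => [//|Y' Z j l iZ st] [e].
by rewrite -e in l; rewrite (len_zero l).
Qed.

Hypothesis noeth : noetherian R.

(** By Nakayama, generating lists of [Y] are the same as lists in [Y] that span Y/nY. *)
Lemma num_gens_len Y k : is_ideal Y -> num_gens Y k <-> len (idprod n Y) Y k.
Proof.
move=> iY; have iP := idprod_ideal n Y.
have killed (s : seq R) : (forall a, a \in s -> Y a) ->
    forall a m, a \in s -> n m -> idprod n Y (m * a).
  by move=> sY a m /sY Ya nm; apply: mem_idprod.
have absorb (s : seq R) : (forall a, a \in s -> Y a) -> Y = adds (idprod n Y) s ->
    peq Y (gen_seq s).
  move=> sY e; rewrite gen_seqE.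
  suff -> : Y = adds (@pzero R) s by [].
  have iZ := adds_ideal s (@pzero_ideal R).
  apply: psub_anti; last by apply: adds_min => // z ->; apply: ideal_zero.
  apply: (nakayama noeth loc) => // y; rewrite {1}e; apply: adds_min.
  - exact: psum_ideal.
  - exact: psub_psumr.
  - by move=> a sa; apply: psub_psuml => //; apply: mem_adds => //; apply: pzero_ideal.
have genY (s : seq R) : peq Y (gen_seq s) ->
    (forall a, a \in s -> Y a) /\ Y = adds (idprod n Y) s.
  rewrite gen_seqE => /peq_eq e.
  have sY a : a \in s -> Y a by rewrite e; apply: mem_adds; apply: pzero_ideal.
  split=> //; apply: psub_anti; last by apply: adds_min => //; apply: idprod_subr.
  rewrite {1}e; apply: adds_mono => // z ->; exact: ideal_zero.
have memY (s : seq R) : Y = adds (idprod n Y) s -> forall a, a \in s -> Y a.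
  by move=> e a sa; rewrite e; apply: mem_adds.
split.
  move=> [[s [ss /genY [sY e]]] minY].
  have [j [hj]] := len_adds_le iP (killed s sY); rewrite -e => lj.
  have [t [ts et]] := len_basis lj.
  have := minY t (absorb t (memY t et) et).
  rewrite ts => hk; have hk' : (j <= k)%N by rewrite -ss.
  by have -> : k = j by apply/eqP; rewrite eqn_leq hk hk'.
move=> l; split.
  by have [s [ss e]] := len_basis l; exists s; split=> //; exact: absorb (memY s e) e.
move=> s /genY [sY e]; apply: (@len_gen_le (idprod n Y)); first exact: killed.
by rewrite -e.
Qed.

End LocalLength.
End Length.

(** * Regular local rings *)

Section Regular.
Variable R : comNzRingType.
Hypothesis noeth : noetherian R.
Hypothesis loc : local_ring R.
Variable d : nat.
Hypothesis chain : exists P : nat -> pset R, prime_chain P d.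
Implicit Types (X Y Z K T : pset R) (s t : seq R) (x y z c : R).
Local Notation n := (@nonunit R).
Local Notation npow := (@npow R).
Local Notation O := (@pzero R).
Let npow_id := npow_ideal loc.

Lemma adds_psum X s : is_ideal X -> adds X s = psum X (adds O s).
Proof.
move=> iX; have iO := adds_ideal s (@pzero_ideal R); apply: psub_anti.
  apply: adds_min; first exact: psum_ideal.
    exact: psub_psuml.
  by move=> a sa; apply: psub_psumr => //; apply: mem_adds => //; apply: pzero_ideal.
apply: psum_sub; first exact: adds_ideal.
  exact: sub_adds.
by apply: adds_mono => // z ->; apply: ideal_zero.
Qed.

(** Nakayama removes the higher power from the inclusion, and the height theorem then applies along
    a chain of length [d]. *)
Lemma param_bound k s : (forall a, a \in s -> n a) ->
  psub (npow k) (psum (adds O s) (npow k.+1)) -> (d <= size s)%N.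
Proof.
move=> sn h; case: chain => P cP; apply: (krull_height noeth loc cP sn (k := k)).
have iO := adds_ideal s (@pzero_ideal R).
have iP0 : is_ideal (P 0%N) by case: cP => /(_ 0%N isT) [].
apply: (@psub_trans _ (adds O s)).
  by apply: (nakayama noeth loc).
by apply: adds_mono => // z ->; apply: ideal_zero.
Qed.

Lemma npow_adj T x k : is_ideal T -> psub n (adj T x) ->
  psub (npow k) (adj T (x ^+ k.+1)).
Proof.
move=> iT h; elim: k => [|k IH]; first by rewrite expr1.
apply: idprod_min; first exact: adj_ideal.
move=> a b /h [r hr] /IH [r' hr']; exists (r * r').
apply: ideal_conv (ideal_add iT (ideal_mulr b iT hr) (ideal_mul (r * x) iT hr')) _.
by rewrite [x ^+ k.+2]exprS; ring.
Qed.

(** Modulo [s] the power n^(k+1) is generated by [x ^+ k.+1]. A unit [c] would put it into (s) +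
    n^(k+2), with fewer than [d] generators. *)
Lemma lead_nonunit s x c k : (forall a, a \in s -> n a) -> (size s < d)%N ->
  psub n (adj (adds O s) x) ->
  psum (adds O s) (npow k.+1) (c * x ^+ k.+1) -> n c.
Proof.
move=> sn hs h hc; apply: NNPP => uc.
have iO := adds_ideal s (@pzero_ideal R).
have iK := psum_ideal iO (npow_id k.+1).
have: (d <= size s)%N; last by rewrite leqNgt hs.
apply: (@param_bound k) => //; apply: psub_trans (npow_adj iO h) _.
apply: adj_min => //; first exact: psub_psuml.
exact: unit_cancel uc hc.
Qed.

(** A minimal generator [x] is completed by d - 1 elements [t] to generators of n. If its square
    were in n^3, [lead_nonunit] with coefficient 1 would make 1 a nonunit. *)
Lemma sq_not_npow2 x : num_gens n d -> n x -> ~ npow 1 x -> ~ npow 2 (x * x).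
Proof.
move=> /(num_gens_len loc noeth _ loc) ln nx nx2 hx.
have kill m : n m -> npow 1 (m * x) by move=> nm; apply: mem_idprod.
have st := comp_step_adj (npow_id 1) kill nx2.
have iA := adj_ideal x (npow_id 1).
have [||p [q [h1 h2 e]]] := len_split ln iA.
- exact: sub_adj.
- by apply: adj_min => //; apply: npowS.
have p1 := comp_step_len (npow_id 1) st h1.
have [t [ts et]] := len_basis h2.
have tn a : a \in t -> n a by move=> ta; rewrite et; apply: mem_adds.
have iO := adds_ideal t (@pzero_ideal R).
have iOx := adj_ideal x iO.
apply: (nonunit_n1 (R := R)); apply: (@lead_nonunit t x 1 1) => //.
- by rewrite ts; lia.
- apply: (nakayama noeth loc) => // z; rewrite {1}et; apply: adds_min.
  + by apply: psum_ideal => //; apply: idprod_ideal.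
  + apply: adj_min.
    * by apply: psum_ideal => //; apply: idprod_ideal.
    * by move=> w hw; apply: psub_psumr.
    * by apply: psub_psuml; [apply: idprod_ideal|apply: mem_adj].
  + move=> a ta; apply: psub_psuml; first exact: idprod_ideal.
    by apply: sub_adj; apply: mem_adds => //; apply: pzero_ideal.
- by apply: psub_psumr => //; rewrite mul1r expr2.
Qed.

Definition gens2 x y := [/\ n x, n y & forall z, n z -> exists a b, z = a * x + b * y].
Definition gens3 x y z :=
  [/\ n x, n y, n z & forall w, n w -> exists a b c, w = a * x + b * y + c * z].

Lemma gens2_sym x y : gens2 x y -> gens2 y x.
Proof. by move=> [nx ny h]; split=> // z /h [a [b ->]]; exists b, a; ring. Qed.

Lemma gens2_shift x y u : gens2 x y -> gens2 x (y - u * x).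
Proof.
move=> [nx ny h]; split=> //.
  by apply: ideal_sub => //; apply: ideal_mul.
by move=> z /h [a [b ->]]; exists (a + b * u), b; ring.
Qed.

Lemma gens3_perm1 x y z : gens3 x y z -> gens3 y x z.
Proof.
by move=> [nx ny nz h]; split=> // w /h [a [b [c ->]]]; exists b, a, c; ring.
Qed.

Lemma gens3_perm2 x y z : gens3 x y z -> gens3 x z y.
Proof.
by move=> [nx ny nz h]; split=> // w /h [a [b [c ->]]]; exists a, c, b; ring.
Qed.

Lemma gens3_shift x y z u : gens3 x y z -> gens3 x (y - u * x) z.
Proof.
move=> [nx ny nz h]; split=> //.
  by apply: ideal_sub => //; apply: ideal_mul.
by move=> w /h [a [b [c ->]]]; exists (a + b * u), b, c; ring.
Qed.

Lemma adds1E y w : adds O [:: y] (y * w).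
Proof. by exists w; rewrite /pzero; ring. Qed.

Lemma adds2E y z w w' : adds O [:: y; z] (y * w + z * w').
Proof. by exists w', w; rewrite /pzero; ring. Qed.

Lemma lead2 x y c w k : d = 2%N -> gens2 x y ->
  npow k.+1 (c * x ^+ k.+1 + y * w) -> n c.
Proof.
move=> d2 [nx ny h] hc; apply: (@lead_nonunit [:: y] x c k).
- by move=> a; rewrite inE => /eqP->.
- by rewrite d2.
- by move=> z /h [a [b ->]]; exists a, b; rewrite /pzero; ring.
- by exists (y * - w), (c * x ^+ k.+1 + y * w); split=> //; [apply: adds1E|ring].
Qed.

Lemma lead3 x y z c w w' k : d = 3%N -> gens3 x y z ->
  npow k.+1 (c * x ^+ k.+1 + y * w + z * w') -> n c.
Proof.
move=> d3 [nx ny nz h] hc; apply: (@lead_nonunit [:: y; z] x c k).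
- by move=> a; rewrite !inE => /orP[] /eqP->.
- by rewrite d3.
- by move=> u /h [a [b [e ->]]]; exists a, e, b; rewrite /pzero; ring.
- exists (y * - w + z * - w'), (c * x ^+ k.+1 + y * w + z * w').
  by split=> //; [apply: adds2E|ring].
Qed.

(** Induction on [k], applied to the ideal of all b with xb and yb in [K]. *)
Lemma npow_gens2 x y k K : gens2 x y -> is_ideal K ->
  (forall i, (i <= k.+1)%N -> K (x ^+ i * y ^+ (k.+1 - i))) -> psub (npow k) K.
Proof.
move=> [nx ny h]; elim: k K => [|k IH] K iK hK.
  move=> z /h [a [b ->]]; apply: ideal_add => //; apply: ideal_mul => //.
    by apply: ideal_conv (hK 1%N isT) _; rewrite subnn expr0 expr1 mulr1.
  by apply: ideal_conv (hK 0%N isT) _; rewrite subn0 expr0 expr1 mul1r.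
pose K' : pset R := fun b => K (x * b) /\ K (y * b).
have iK' : is_ideal K'.
  split; rewrite /K'.
  - by rewrite !mulr0; split; apply: ideal_zero.
  - by move=> a b [h1 h2] [h3 h4]; rewrite !mulrDr; split; apply: ideal_add.
  - by move=> r a [h1 h2]; rewrite !(mulrCA _ r); split; apply: ideal_mul.
apply: idprod_min => // a b /h [r [s ->]] hb.
have [|h1 h2] := IH K' iK' _ b hb.
  move=> i hi; split.
    by apply: ideal_conv (hK i.+1 hi) _; rewrite subSS exprS mulrA.
  by apply: ideal_conv (hK i (leqW hi)) _; rewrite subSn // [y ^+ _.+1]exprS; ring.
by apply: ideal_conv (ideal_add iK (ideal_mul r iK h1) (ideal_mul s iK h2)) _; ring.
Qed.

Lemma npow_scale c k x : n c -> npow k x -> npow k.+1 (c * x).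
Proof. exact: mem_idprod. Qed.

(* The only binary cubics vanishing at every rational point are multiples of
   xy(x - y) over the field with two elements. It is excluded by the
   quadratic parameter x^2 + xy + y^2, which has no rational zero there. *)
Lemma cubic_indep x y c0 c1 c2 c3 : d = 2%N -> gens2 x y ->
  npow 3 (c0 * (x * x * x) + c1 * (x * x * y) + c2 * (x * y * y) + c3 * (y * y * y)) ->
  [/\ n c0, n c1, n c2 & n c3].
Proof.
move=> d2 g hc; have [nx ny _] := g.
have nc0 : n c0.
  apply: (@lead2 x y c0 (c1 * (x * x) + c2 * (x * y) + c3 * (y * y)) 2) => //.
  by apply: ideal_conv hc _; ring.
have nc3 : n c3.
  apply: (@lead2 y x c3 (c2 * (y * y) + c1 * (x * y) + c0 * (x * x)) 2) => //.
    exact: gens2_sym.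
  by apply: ideal_conv hc _; ring.
have mon a b c : n a -> n b -> n c -> npow 2 (a * b * c).
  by move=> na nb nc; rewrite -mulrA; apply: mem_idprod => //; apply: mem_idprod.
have i3 := npow_id 3.
have h12 : npow 3 (c1 * (x * x * y) + c2 * (x * y * y)).
  have h0 : npow 3 (c0 * (x * x * x)) by apply: npow_scale => //; apply: mon.
  have h3 : npow 3 (c3 * (y * y * y)) by apply: npow_scale => //; apply: mon.
  by apply: ideal_conv (ideal_sub i3 (ideal_sub i3 hc h0) h3) _; ring.
(* This is the coefficient of the cube of [x] once [y] is replaced by [y - u * x]. The values 1 and
   -1 of [u] show that a unit [c1] forces 2 into n. *)
have hs u : n (u * (c1 + c2 * u)).
  have g' := gens2_shift u g.
  apply: (@lead2 x (y - u * x) _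
    (c1 * (x * x) + c2 * x * (y - u * x + 2%:R * u * x)) 2) => //.
  by apply: ideal_conv h12 _; ring.
have s1 : n (c1 + c2) by apply: ideal_conv (hs 1) _; ring.
have s2 : n (c1 - c2) by apply: ideal_conv (ideal_opp loc (hs (-1))) _; ring.
case: (classic (n c1)) => nc1.
  by split=> //; apply: ideal_conv (ideal_sub loc s1 nc1) _; ring.
exfalso.
have n2 : n 2%:R.
  apply: (unit_cancel loc nc1).
  by apply: ideal_conv (ideal_add loc s1 s2) _; ring.
have f3 : npow 3 (x * x * y - x * y * y).
  apply: (unit_cancel i3 nc1).
  have h : npow 3 ((c1 + c2) * (x * y * y)) by apply: npow_scale => //; apply: mon.
  by apply: ideal_conv (ideal_sub i3 h12 h) _; ring.
pose g2 := x * x + x * y + y * y.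
pose K := psum (adds O [:: g2]) (npow 4).
have iO := adds_ideal [:: g2] (@pzero_ideal R).
have iK : is_ideal K by apply: psum_ideal.
have K4 z : npow 4 z -> K z by move=> h; apply: psub_psumr.
have Kg w : K (g2 * w) by apply: psub_psuml => //; apply: adds1E.
have K2 a b c e : n a -> n b -> n c -> n e -> K (2%:R * (a * b * c * e)).
  move=> na nb nc ne; apply: K4; apply: npow_scale => //.
  by rewrite -!mulrA; do 3!apply: mem_idprod => //.
have Kf w : n w -> K (w * (x * x * y - x * y * y)).
  by move=> nw; apply: K4; apply: npow_scale.
(* It remains to derive all quartic monomials from [g2], 2 and the cubic [f3], modulo n^5. Then n^4
   lies in (g2) + n^5, impossible in dimension two. *)
suff h : psub (npow 3) K.
  have /(_ _ h) := @param_bound 3 [:: g2]; rewrite d2 /= => /(_ _) H.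
  suff: (2 <= 1)%N by [].
  apply: H => a; rewrite inE => /eqP ->.
  by rewrite /g2; repeat (apply: ideal_add || apply: ideal_mul) => //.
have m31 : K (x * x * x * y).
  apply: ideal_conv (ideal_sub iK (ideal_sub iK (Kg (x * y)) (Kf y ny))
    (K2 x y y y nx ny ny ny)) _.
  by rewrite /g2; ring.
have m22 : K (x * x * y * y).
  by apply: ideal_conv (ideal_sub iK m31 (Kf x nx)) _; ring.
have m13 : K (x * y * y * y).
  apply: ideal_conv (ideal_sub iK (ideal_sub iK (Kg (x * y)) (Kf x nx))
    (K2 x x y y nx nx ny ny)) _.
  by rewrite /g2; ring.
have m40 : K (x * x * x * x).
  apply: ideal_conv (ideal_sub iK (ideal_sub iK (Kg (x * x)) (Kf x nx))
    (K2 x x y y nx nx ny ny)) _.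
  by rewrite /g2; ring.
have m04 : K (y * y * y * y).
  apply: ideal_conv (ideal_sub iK (ideal_sub iK (Kg (y * y)) (Kf y ny))
    (K2 x y y y nx ny ny ny)) _.
  by rewrite /g2; ring.
apply: (npow_gens2 g iK) => -[|[|[|[|[|//]]]]] _.
- by apply: ideal_conv m04 _; rewrite /=; ring.
- by apply: ideal_conv m13 _; rewrite /=; ring.
- by apply: ideal_conv m22 _; rewrite /=; ring.
- by apply: ideal_conv m31 _; rewrite /=; ring.
- by apply: ideal_conv m40 _; rewrite /=; ring.
Qed.

Definition quad2 x y (c0 c1 c2 : R) := c0 * (x * x) + c1 * (x * y) + c2 * (y * y).

Lemma npow1_gens2 x y z : gens2 x y -> npow 1 z -> exists c0 c1 c2, z = quad2 x y c0 c1 c2.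
Proof.
move=> [nx ny h].
pose K : pset R := fun z => exists c0 c1 c2, z = quad2 x y c0 c1 c2.
suff hK : psub (npow 1) K by exact: hK.
apply: idprod_min.
  split.
  - by exists 0, 0, 0; rewrite /quad2; ring.
  - move=> _ _ [a0 [a1 [a2 ->]]] [b0 [b1 [b2 ->]]].
    by exists (a0 + b0), (a1 + b1), (a2 + b2); rewrite /quad2; ring.
  - move=> r _ [a0 [a1 [a2 ->]]].
    by exists (r * a0), (r * a1), (r * a2); rewrite /quad2; ring.
move=> _ _ /h [a [b ->]] /h [a' [b' ->]].
by exists (a * a'), (a * b' + b * a'), (b * b'); rewrite /quad2; ring.
Qed.

Lemma npow_sq a b : n a -> n b -> npow 1 (a * b).
Proof. exact: mem_idprod. Qed.

Lemma npow2_quad2 x y c0 c1 c2 : gens2 x y -> n c0 -> n c1 -> n c2 ->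
  npow 2 (quad2 x y c0 c1 c2).
Proof.
move=> [nx ny _] h0 h1 h2; have i2 := npow_id 2; rewrite /quad2.
by apply: (ideal_add i2); first apply: (ideal_add i2); apply: npow_scale => //; apply: npow_sq.
Qed.

Lemma len_quad2_le x y X j : gens2 x y -> is_ideal X -> psub (npow 2) X ->
  len X (npow 1) j -> (j <= 3)%N.
Proof.
move=> g iX h2 l; have [_ _ XY] := len_id l; have [nx ny _] := g.
pose s := [:: x * x; x * y; y * y].
have e : npow 1 = adds X s.
  apply: psub_anti.
    move=> z /(npow1_gens2 g) [c0 [c1 [c2 ->]]]; exists c2, c1, c0.
    by apply: ideal_conv (ideal_zero iX) _; rewrite /quad2; ring.
  apply: adds_min => // a; rewrite !inE => /or3P[] /eqP->; exact: npow_sq.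
rewrite e in l; apply: (len_gen_le _ l) => a m; rewrite !inE => /or3P[] /eqP-> nm.
all: by apply: h2; apply: npow_scale => //; apply: npow_sq.
Qed.

Lemma gens2_of_num_gens : num_gens n 2 -> exists x y, gens2 x y.
Proof.
move=> [[s [ss e]] _]; move: e; rewrite gen_seqE.
case: s ss => [|x [|y [|]]] // _ /peq_eq e; exists y, x; split.
- by rewrite e; apply: mem_adds; [apply: pzero_ideal|rewrite !inE eqxx orbT].
- by rewrite e; apply: mem_adds; [apply: pzero_ideal|rewrite inE eqxx].
move=> z; rewrite e => -[a [b h]]; exists a, b.
by move: h; rewrite /pzero => /eqP; rewrite subr_eq0 => /eqP <-; ring.
Qed.

Lemma gens3_of_num_gens : num_gens n 3 -> exists x y z, gens3 x y z.
Proof.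
move=> [[s [ss e]] _]; move: e; rewrite gen_seqE.
case: s ss => [|x [|y [|z [|]]]] // _ /peq_eq e; exists z, y, x; split.
- by rewrite e; apply: mem_adds; [apply: pzero_ideal|rewrite !inE eqxx !orbT].
- by rewrite e; apply: mem_adds; [apply: pzero_ideal|rewrite !inE eqxx !orbT].
- by rewrite e; apply: mem_adds; [apply: pzero_ideal|rewrite inE eqxx].
move=> w; rewrite e => -[a [b [c h]]]; exists a, b, c.
by move: h; rewrite /pzero => /eqP; rewrite subr_eq0 => /eqP <-; ring.
Qed.

Definition quad3 x y z (c1 c2 c3 c4 c5 c6 : R) :=
  c1 * (x * x) + c2 * (y * y) + c3 * (z * z) + c4 * (x * y) + c5 * (x * z) + c6 * (y * z).

Lemma npow1_gens3 x y z w : gens3 x y z -> npow 1 w ->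
  exists c1 c2 c3 c4 c5 c6, w = quad3 x y z c1 c2 c3 c4 c5 c6.
Proof.
move=> [nx ny nz h].
pose K : pset R := fun w => exists c1 c2 c3 c4 c5 c6, w = quad3 x y z c1 c2 c3 c4 c5 c6.
suff hK : psub (npow 1) K by exact: hK.
apply: idprod_min.
  split.
  - by exists 0, 0, 0, 0, 0, 0; rewrite /quad3; ring.
  - move=> _ _ [a1 [a2 [a3 [a4 [a5 [a6 ->]]]]]] [b1 [b2 [b3 [b4 [b5 [b6 ->]]]]]].
    exists (a1 + b1), (a2 + b2), (a3 + b3), (a4 + b4), (a5 + b5), (a6 + b6).
    by rewrite /quad3; ring.
  - move=> r _ [a1 [a2 [a3 [a4 [a5 [a6 ->]]]]]].
    exists (r * a1), (r * a2), (r * a3), (r * a4), (r * a5), (r * a6).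
    by rewrite /quad3; ring.
move=> _ _ /h [a [b [c ->]]] /h [a' [b' [c' ->]]].
exists (a * a'), (b * b'), (c * c'), (a * b' + b * a'), (a * c' + c * a'), (b * c' + c * b').
by rewrite /quad3; ring.
Qed.

(* A quadratic form vanishing at the points e_i and e_i + e_j is zero, so the
   leading coefficients in suitable coordinates suffice over any residue field. *)
Lemma quad_indep x y z c1 c2 c3 c4 c5 c6 : d = 3%N -> gens3 x y z ->
  npow 2 (quad3 x y z c1 c2 c3 c4 c5 c6) ->
  [/\ n c1, n c2, n c3 & [/\ n c4, n c5 & n c6]].
Proof.
move=> d3 g; have [nx ny nz _] := g; rewrite /quad3 => h.
have i2 := npow_id 2.
have sq c a : n c -> n a -> npow 2 (c * (a * a)).
  by move=> nc na; apply: npow_scale => //; apply: npow_sq.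
have h1 : n c1.
  apply: (@lead3 x y z c1 (c2 * y + c4 * x + c6 * z) (c3 * z + c5 * x) 1) => //.
  by apply: ideal_conv h _; ring.
have h2 : n c2.
  apply: (@lead3 y x z c2 (c1 * x + c4 * y + c5 * z) (c3 * z + c6 * y) 1) => //.
    exact: gens3_perm1.
  by apply: ideal_conv h _; ring.
have h3 : n c3.
  apply: (@lead3 z x y c3 (c1 * x + c4 * y + c5 * z) (c2 * y + c6 * z) 1) => //.
    exact/gens3_perm1/gens3_perm2.
  by apply: ideal_conv h _; ring.
have {}h : npow 2 (c4 * (x * y) + c5 * (x * z) + c6 * (y * z)).
  apply: ideal_conv (ideal_sub i2 (ideal_sub i2 (ideal_sub i2 h
    (sq c1 x h1 nx)) (sq c2 y h2 ny)) (sq c3 z h3 nz)) _.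
  by ring.
split=> //; split.
- apply: (@lead3 x (y - 1 * x) z c4 (c4 * x) (c5 * x + c6 * y) 1) => //.
    exact: gens3_shift.
  by apply: ideal_conv h _; ring.
- apply: (@lead3 x (z - 1 * x) y c5 (c5 * x) (c4 * x + c6 * z) 1) => //.
    exact/gens3_shift/gens3_perm2.
  by apply: ideal_conv h _; ring.
- apply: (@lead3 y (z - 1 * y) x c6 (c6 * y) (c4 * y + c5 * z) 1) => //.
    exact/gens3_shift/gens3_perm2/gens3_perm1.
  by apply: ideal_conv h _; ring.
Qed.

Lemma len_quad3 : d = 3%N -> num_gens n 3 -> len (npow 2) (npow 1) 6.
Proof.
move=> d3 /gens3_of_num_gens [x [y [z g]]]; have [nx ny nz _] := g.
have i1 := npow_id 1; have i2 := npow_id 2.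
pose s := [:: x * x; y * y; z * z; x * y; x * z; y * z].
have sn a : a \in s -> npow 1 a.
  by rewrite !inE => /orP[/eqP->|/orP[/eqP->|/orP[/eqP->|/or3P[] /eqP->]]];
    apply: npow_sq.
have -> : npow 1 = adds (npow 2) s.
  apply: psub_anti; last first.
    apply: adds_min => //; exact: (npowS loc (k := 1)).
  move=> w /(npow1_gens3 g) [c1 [c2 [c3 [c4 [c5 [c6 ->]]]]]].
  exists c6, c5, c4, c3, c2, c1.
  by apply: ideal_conv (ideal_zero i2) _; rewrite /quad3; ring.
have one : ~ n 1 := @nonunit_n1 R.
apply: len_indep => //.
  by move=> a m sa nm; apply: npow_scale => //; apply: sn.
have q c1 c2 c3 c4 c5 c6 w : npow 2 w -> w = quad3 x y z c1 c2 c3 c4 c5 c6 ->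
    [/\ n c1, n c2, n c3 & [/\ n c4, n c5 & n c6]].
  by move=> h e; apply: (quad_indep d3 g); rewrite -e.
(* Each failure of independence is a quadratic form in n^3 with one coefficient equal to 1, against
   [q]. *)
split; [|split; [|split; [|split; [|split; [|split=> //]]]]].
- move=> h; have [] : [/\ n 1, n 0, n 0 & [/\ n 0, n 0 & n 0]] by
    apply: (q _ _ _ _ _ _ _ h); rewrite /quad3; ring.
  by [].
- move=> [r1 h]; have [] : [/\ n (- r1), n 1, n 0 & [/\ n 0, n 0 & n 0]] by
    apply: (q _ _ _ _ _ _ _ h); rewrite /quad3; ring.
  by [].
- move=> [r2 [r1 h]]; have [] : [/\ n (- r1), n (- r2), n 1 & [/\ n 0, n 0 & n 0]] by
    apply: (q _ _ _ _ _ _ _ h); rewrite /quad3; ring.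
  by [].
- move=> [r3 [r2 [r1 h]]].
  have [_ _ _ []] : [/\ n (- r1), n (- r2), n (- r3) & [/\ n 1, n 0 & n 0]] by
    apply: (q _ _ _ _ _ _ _ h); rewrite /quad3; ring.
  by [].
- move=> [r4 [r3 [r2 [r1 h]]]].
  have [_ _ _ []] : [/\ n (- r1), n (- r2), n (- r3) & [/\ n (- r4), n 1 & n 0]] by
    apply: (q _ _ _ _ _ _ _ h); rewrite /quad3; ring.
  by [].
- move=> [r5 [r4 [r3 [r2 [r1 h]]]]].
  have [_ _ _ []] : [/\ n (- r1), n (- r2), n (- r3) & [/\ n (- r4), n (- r5) & n 1]] by
    apply: (q _ _ _ _ _ _ _ h); rewrite /quad3; ring.
  by [].
Qed.
End Regular.

(** * Ideals of colength six *)

Section ColengthSix.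
Variable R : comNzRingType.
Hypothesis noeth : noetherian R.
Hypothesis loc : local_ring R.
Variable d : nat.
Hypothesis chain : exists P : nat -> pset R, prime_chain P d.
Local Notation n := (@nonunit R).
Hypothesis emb : num_gens n d.
Local Notation npow := (@npow R).
Variable I : pset R.
Hypothesis iI : is_ideal I.
Hypothesis In2 : psub I (npow 1).
Hypothesis radI : forall x, n x -> exists k, I (x ^+ k).
Hypothesis length6 : len I (@pfull R) 6.
Local Notation soc := (colon I n).
Hypothesis not_burch : idprod n soc = idprod n I.
Hypothesis not_gor : ~ comp_step I soc.
Implicit Types (x y z p q r t u v w : R).

Let npow_id := npow_ideal loc.
Let len_emb : len (npow 1) n d := proj1 (num_gens_len loc noeth d loc) emb.

Lemma npow1_n : psub (npow 1) n.
Proof. exact: (npowS loc (k := 0)). Qed.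

Lemma comp_step_nonunit : comp_step n (@pfull R).
Proof.
split; first by split=> //; exists 1; split=> //; apply: nonunit_n1.
move=> C iC nC _; case: (classic (C 1)) => C1; last by left; apply: nonunit_sub.
by right=> x _; rewrite -[x]mulr1; apply: ideal_mul.
Qed.

Lemma len_nonunit : len I n 5.
Proof.
have In : psub I n by apply: psub_trans In2 npow1_n.
have [p [q [h1 h2 e]]] := len_split length6 loc In (fun _ _ => Logic.I).
have q1 := comp_step_len loc comp_step_nonunit h2.
by have <- : p = 5%N by lia.
Qed.

Lemma nonunit_not_in_I : ~ psub n I.
Proof.
move=> h; have e : n = I by apply: psub_anti => // x /In2/npow1_n.
by have := len_refl_eq0 len_nonunit e.
Qed.

Lemma soc_ideal : is_ideal soc. Proof. exact: colon_ideal. Qed.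

(* Where the Burch condition enters: n(I:n) = nI lies in n^3, while the square
   of a minimal generator of n does not. *)
Lemma soc_npow1 : psub soc (npow 1).
Proof.
move=> x hx; have nx : n x.
  apply: NNPP => ux; apply: nonunit_not_in_I => y /hx.
  exact: unit_cancel.
apply: NNPP => nx2; apply: (sq_not_npow2 noeth loc chain emb nx nx2).
have : idprod n I (x * x) by rewrite -not_burch; apply: mem_idprod.
exact: idprod_mono.
Qed.

Local Notation I3 := (psum I (npow 2)).

Lemma I3_ideal : is_ideal I3. Proof. exact: psum_ideal. Qed.
Hint Resolve I3_ideal soc_ideal : core.

Lemma I3_npow1 : psub I3 (npow 1).
Proof. by apply: psum_sub => //; apply: npowS. Qed.

(** The length 5 of n/I is cut along I, I + n^3, n^2 and n. So [h] is the value of the Hilbert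
    function of S/I in degree two, and [c] collects the degrees above. *)
Lemma hilbert_function :
  exists h c, [/\ len I I3 c, len I3 (npow 1) h & (d + h + c = 5%N)%N].
Proof.
have [a [b [h1 h2 e1]]] := len_split len_nonunit (npow_id 1) In2 npow1_n.
have [c [h [h3 h4 e2]]] := len_split h1 I3_ideal (psub_psuml (npow_id 2)) I3_npow1.
exists h, c; split=> //.
by rewrite (len_uniq len_emb h2); lia.
Qed.

Lemma least_nat (P : nat -> Prop) : (exists k, P k) ->
  exists k, P k /\ forall j, (j < k)%N -> ~ P j.
Proof.
move=> [k Pk]; apply: NNPP => none.
suff H i : forall j, (j < i)%N -> ~ P j by apply: (H k.+1 k).
elim: i => [//|i IH] j; rewrite ltnS leq_eqVlt => /orP[/eqP->|]; last exact: IH.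
by move=> Pi; apply: none; exists i.
Qed.

(* If n^2/I is cyclic, it is generated by a product xy, and then
   I:n = I + (x^i xy) for the last i with x^i xy outside I. *)
Lemma hilbert_ge2 h : len I3 (npow 1) h -> (2 <= h)%N.
Proof.
move=> lh; rewrite ltnNge; apply/negP => h1; apply: not_gor.
(* Otherwise Nakayama gives n^2 inside [I]; then n lies in the socle, hence in n^2, hence in [I]. *)
have [x [y [nx ny nxy]]] : exists x y, [/\ n x, n y & ~ I3 (x * y)].
  apply: NNPP => none.
  have n2I : psub (npow 1) I.
    apply: (nakayama noeth loc) => //; apply: idprod_min => // x y nx ny.
    by apply: NNPP => hn; apply: none; exists x, y.
  have nsoc : psub n soc by move=> x nx y ny; apply: n2I; apply: mem_idprod.
  by apply: nonunit_not_in_I => x /nsoc /soc_npow1 /n2I.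
have xy2 : npow 1 (x * y) by apply: mem_idprod.
have n2 : psub (npow 1) (adj I (x * y)).
  have h11 : h = 1%N.
    suff : h <> 0%N by lia.
    by move=> h0; rewrite h0 in lh; apply: nxy; rewrite (len_zero lh).
  rewrite h11 in lh; have [_ simple] := len1_step lh.
  have [||| hh | hh] := simple (adj I3 (x * y)).
  - exact: adj_ideal.
  - exact: sub_adj.
  - by apply: adj_min => //; apply: I3_npow1.
  - by case: nxy; apply: hh; apply: mem_adj.
  have iA := adj_ideal (x * y) iI.
  have iP := idprod_ideal n (npow 1).
  apply: (nakayama noeth loc) => // z /hh; apply: adj_min; first exact: psum_ideal.
    move=> _ [a [b [ha hb ->]]]; exists a, b.
    by split; [apply: sub_adj|exact: hb|].
  by apply: psub_psuml => //; apply: mem_adj.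
pose m i := x ^+ i * (x * y).
(* Writing [a * y] as a multiple of [x * y] modulo [I] trades the factor [a] for one more factor
   [x]. *)
have shift i a : n a -> exists b, I (a * m i - b * m i.+1).
  move=> na; have [|b hb] := n2 (a * y); first exact: mem_idprod.
  exists b; apply: ideal_conv (ideal_mul (x ^+ i * x) iI hb) _.
  by rewrite /m exprS; ring.
have [k [Ik mink]] : exists k, I (m k) /\ forall j, (j < k)%N -> ~ I (m j).
  apply: least_nat; have [k hk] := radI nx.
  by exists k; apply: ideal_mulr.
case: k Ik mink => [|k] Ik mink.
  by case: nxy; apply: psub_psuml => //; move: Ik; rewrite /m expr0 mul1r.
have nIk : ~ I (m k) by apply: mink.
have nm a : n a -> I (a * m k).
  move=> /(shift k) [b hb].
  by apply: ideal_conv (ideal_add iI hb (ideal_mul b iI Ik)) _; ring.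
suff -> : soc = adj I (m k) by apply: comp_step_adj.
have iA := adj_ideal (m k) iI.
apply: psub_anti; last first.
  apply: adj_min => //; first by move=> z Iz u _; apply: ideal_mulr.
  by move=> u nu; rewrite mulrC; apply: nm.
(* A socle element is a multiple of [m j] for every j up to [k]: before stage [k] its coefficient is
   not a unit, since multiplying by [x] would put [m j.+1] into [I], so [shift] applies. *)
move=> s hs; suff H j : (j <= k)%N -> adj I (m j) s by apply: H.
elim: j => [_|j IH hj].
  by rewrite /m expr0 mul1r; exact: n2 (soc_npow1 hs).
have [|a ha] := IH; first by lia.
case: (classic (n a)) => na.
  have [b hb] := shift j a na; exists b.
  by apply: ideal_conv (ideal_add iI ha hb) _; ring.
case: (mink j.+1); first by lia.
apply: (unit_cancel iI na).
apply: ideal_conv (ideal_sub iI (hs x nx) (ideal_mul x iI ha)) _.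
by rewrite /m exprS; ring.
Qed.

(** If n were generated by a single [t], n^2 would be generated by its square modulo I + n^3,
    against [hilbert_ge2]. An empty list of generators is treated with t = 0. *)
Lemma dim_ge2 : (2 <= d)%N.
Proof.
have [h [c [_ lh _]]] := hilbert_function.
have h2 := hilbert_ge2 lh.
rewrite ltnNge; apply/negP => hd.
case: emb => -[s [ss e]] _; move: e; rewrite gen_seqE => /peq_eq e.
have hle t : psub n (adds (@pzero R) [:: t]) -> n t -> False.
  move=> nt t1; have n2 : npow 1 = adds I3 [:: t * t].
    apply: psub_anti; last first.
      apply: adds_min => //; first exact: I3_npow1.
      by move=> a; rewrite inE => /eqP ->; apply: mem_idprod.
    apply: idprod_min; first exact: adj_ideal.
    move=> a b /nt [r hr] /nt [r' hr']; exists (r * r').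
    have -> : a = r * t by move: hr => /eqP; rewrite subr_eq0 => /eqP.
    have -> : b = r' * t by move: hr' => /eqP; rewrite subr_eq0 => /eqP.
    by apply: ideal_conv (ideal_zero I3_ideal) _; ring.
  rewrite n2 in lh; have : (h <= 1)%N; last by lia.
  apply: (len_gen_le _ lh) => a m; rewrite inE => /eqP -> nm.
  apply: psub_psumr => //; apply: mem_idprod => //; exact: mem_idprod.
case: s ss e => [|t [|u s]] /= ss e.
- apply: (hle 0); last exact: ideal_zero.
  by rewrite e => z ->; apply: sub_adj.
- apply: (hle t); first by rewrite {1}e.
  by rewrite e; apply: mem_adj; apply: pzero_ideal.
by rewrite -ss in hd.
Qed.

Lemma dim_neq2 : d <> 2%N.
Proof.
move=> d2.
have [x [y g]] : exists x y, gens2 x y by apply: gens2_of_num_gens; rewrite -d2.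
have [nx ny gen] := g.
have [h [c [lc lh e]]] := hilbert_function.
have h2 := hilbert_ge2 lh.
(* Here c is at most 1. If c = 0, then n^3 lies in [I] and n^2 in the socle. If c = 1, the socle
   contains the simple step I + n^3, and properly so because S/I is not Gorenstein. *)
have [q [socq nq]] : exists q, soc q /\ ~ I3 q.
  have c01 : c = 0%N \/ c = 1%N by lia.
  case: c01 => c01; rewrite c01 in lc.
    have e3 := len_zero lc.
    have [z [hz nz]] : exists z, npow 1 z /\ ~ I3 z.
      apply: not_psub => hh; have := @len_refl_eq0 _ _ _ _ lh.
      have -> : npow 1 = I3 by apply: psub_anti => //; apply: I3_npow1.
      by move=> /(_ erefl); lia.
    exists z; split=> // m nm; rewrite e3; apply: psub_psumr => //.
    by rewrite mulrC; apply: mem_idprod.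
  have st := len1_step lc.
  apply: not_psub => hh; apply: not_gor; suff -> : soc = I3 by [].
  apply: psub_anti => // z hz m nm; rewrite mulrC.
  exact: (comp_step_kill loc iI I3_ideal st).
(* The length of n^2/n^3 is at most three, and at least two of it survives modulo [I], so [I] has at
   most one quadratic form modulo n^3. *)
have [F [IF hF]] : exists F, I F /\ psub I (adj (npow 2) F).
  case: (classic (psub I (npow 2))) => hI.
    exists 0; split; first exact: ideal_zero.
    by apply: psub_trans hI _; apply: sub_adj.
  have [F [IF nF]] := not_psub hI; exists F; split=> //.
  have kill a m : a \in [:: x * x; x * y; y * y] -> n m -> npow 2 (m * a).
    by rewrite !inE => /or3P[] /eqP -> nm; apply: mem_idprod => //; apply: mem_idprod.
  have [j [_ lj]] := len_adds_le (npow_id 2) kill.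
  have en : adds (npow 2) [:: x * x; x * y; y * y] = npow 1.
    apply: psub_anti.
      apply: adds_min => //; first exact: (npowS loc (k := 1)).
      by move=> a; rewrite !inE => /or3P[] /eqP ->; apply: mem_idprod.
    move=> z /(npow1_gens2 g) [c0 [c1 [c2 ->]]]; exists c2, c1, c0.
    by apply: ideal_conv (ideal_zero (npow_id 2)) _; rewrite /quad2; ring.
  rewrite en in lj.
  have j3 : (j <= 3)%N by apply: (len_quad2_le loc g _ _ lj).
  have [p [h' [l1 l2 e2]]] := len_split lj I3_ideal (psub_psumr iI) I3_npow1.
  have eh := len_uniq lh l2.
  have killF m : n m -> npow 2 (m * F) by move=> nm; apply: mem_idprod => //; apply: In2.
  have st := comp_step_adj (npow_id 2) killF nF.
  have lF := lenS (len0 (npow_id 2)) (adj_ideal F (npow_id 2)) st.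
  have FI3 : psub (adj (npow 2) F) I3.
    by apply: adj_min => //; [apply: psub_psumr|apply: psub_psuml].
  have p1 : (1 <= p)%N by apply: (len_sub_le l1 lF).
  have ep : p = 1%N by lia.
  rewrite ep in l1; rewrite (len_eq l1 lF FI3); exact: psub_psuml.
have [q0 [q1 [q2 eq]]] := npow1_gens2 g (soc_npow1 socq).
have [f0 [f1 [f2 ef]]] := npow1_gens2 g (In2 IF).
(* By the failure of the Burch condition [m * q] lies in nI, that is in nF + n^4. *)
have red m : n m -> exists a b, npow 3 (m * q - (a * x + b * y) * F).
  move=> nm.
  pose K : pset R := fun z => exists l, n l /\ npow 3 (z - l * F).
  have iK : is_ideal K.
    split.
    - exists 0; split; first exact: ideal_zero.
      by apply: ideal_conv (ideal_zero (npow_id 3)) _; ring.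
    - move=> a b [l [nl hl]] [l' [nl' hl']]; exists (l + l').
      split; first exact: ideal_add.
      by apply: ideal_conv (ideal_add (npow_id 3) hl hl') _; ring.
    - move=> s a [l [nl hl]]; exists (s * l); split; first exact: ideal_mul.
      by apply: ideal_conv (ideal_mul s (npow_id 3) hl) _; ring.
  have : idprod n I (m * q) by rewrite -not_burch; apply: mem_idprod.
  have hK : psub (idprod n I) K.
    apply: idprod_min => // a f na /hF [s hs]; exists (a * s).
    split; first exact: ideal_mulr.
    have hh : npow 3 (a * (f - s * F)) by apply: mem_idprod.
    by apply: ideal_conv hh _; ring.
  by move=> /hK [l [/gen [a [b ->]] hl]]; exists a, b.
have [a [b hx]] := red x nx; have [a' [b' hy]] := red y ny.
(* The coefficients of xq - (ax + by)F, and then those of yq - (a'x + b'y)F, are nonunits. *)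
have [|x0 x1 x2 x3] := @cubic_indep _ noeth loc _ chain x y (q0 - a * f0)
  (q1 - a * f1 - b * f0) (q2 - a * f2 - b * f1) (- (b * f2)) d2 g.
  by apply: ideal_conv hx _; rewrite eq ef /quad2; ring.
have [|y0 y1 y2 y3] := @cubic_indep _ noeth loc _ chain x y (- (a' * f0))
  (q0 - a' * f1 - b' * f0) (q1 - a' * f2 - b' * f1) (q2 - b' * f2) d2 g.
  by apply: ideal_conv hy _; rewrite eq ef /quad2; ring.
apply: nq.
have M u v : n v -> n (u * v) by apply: ideal_mul.
have A u v : n (u - v) -> n v -> n u.
  by move=> h3 h4; apply: ideal_conv (ideal_add loc h3 h4) _; ring.
(* If [b] is a nonunit, [q] is [a * F] modulo n^3. If it is a unit, the eight relations successively
   make f2, q2, f1, q1, f0, q0 nonunits, so [q] is in n^3. *)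
case: (classic (n b)) => nb.
  have hq : npow 2 (q - a * F).
    have hh : npow 2 (quad2 x y (q0 - a * f0) (q1 - a * f1) (q2 - a * f2)).
      apply: npow2_quad2 => //.
        by apply: A x1 _; apply: ideal_mulr.
      by apply: A x2 _; apply: ideal_mulr.
    by apply: ideal_conv hh _; rewrite eq ef /quad2; ring.
  by exists (a * F), (q - a * F); split=> //; [apply: ideal_mul|ring].
have C v : n (b * v) -> n v by apply: unit_cancel.
have nf2 : n f2 by apply: C; apply: ideal_conv (ideal_opp loc x3) _; ring.
have nq2 : n q2 by apply: A y3 _; apply: M.
have nf1 : n f1.
  apply: C; apply: ideal_conv (ideal_sub loc (ideal_sub loc nq2 x2) (M a _ nf2)) _; ring.
have nq1 : n q1.
  by apply: (A _ (a' * f2)); [apply: A y2 _; apply: M|apply: M].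
have nf0 : n f0.
  apply: C; apply: ideal_conv (ideal_sub loc (ideal_sub loc nq1 x1) (M a _ nf1)) _; ring.
have nq0 : n q0.
  by apply: A x0 _; apply: M.
by apply: psub_psumr => //; rewrite eq; apply: npow2_quad2.
Qed.

(** From d + h + c = 5, h at least 2 and d at least 3, the only solution is (3, 2, 0). *)
Lemma dim3_data : [/\ d = 3%N, psub (npow 2) I & len I (npow 1) 2].
Proof.
have [h [c [lc lh e]]] := hilbert_function.
have h2 := hilbert_ge2 lh; have d2 := dim_ge2; have dn2 := dim_neq2.
have d3 : d = 3%N by lia.
have c0 : c = 0%N by lia.
have hh : h = 2%N by lia.
rewrite c0 in lc; rewrite hh -(len_zero lc) in lh; split=> //.
by rewrite (len_zero lc); apply: psub_psumr.
Qed.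

Lemma soc_eq : soc = npow 1.
Proof.
have [_ h _] := dim3_data; apply: psub_anti; first exact: soc_npow1.
by move=> x hx m nm; apply: h; rewrite mulrC; apply: mem_idprod.
Qed.

Lemma idprod_I : idprod n I = npow 2.
Proof. by rewrite -not_burch soc_eq. Qed.

(** Since nI = n^3, the number of generators is the length of I/n^3, which is 6 - 2. *)
Lemma num_gens_I : num_gens I 4.
Proof.
have [d3 h3 l2] := dim3_data.
apply/(num_gens_len loc noeth _ iI); rewrite idprod_I.
have emb3 : num_gens n 3 by rewrite -d3.
have l6 := len_quad3 noeth loc chain d3 emb3.
have [p [q [l1 l3 e]]] := len_split l6 iI h3 In2.
have e2 := len_uniq l2 l3.
by have <- : p = 4%N by lia.
Qed.
End ColengthSix.

(** * Exact pairs of zero divisors *)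

Section ExactPair.
Variable R : comNzRingType.
Hypothesis noeth : noetherian R.
Hypothesis loc : local_ring R.
Hypothesis chain : exists P : nat -> pset R, prime_chain P 3.
Local Notation n := (@nonunit R).
Hypothesis emb : num_gens n 3.
Local Notation npow := (@npow R).
Variable I : pset R.
Hypothesis iI : is_ideal I.
Hypothesis In2 : psub I (npow 1).
Hypothesis n3I : psub (npow 2) I.
Hypothesis len_sq : len I (npow 1) 2.
Hypothesis soc_sq : forall x, n x -> (forall y, n y -> I (x * y)) -> npow 1 x.
Hypothesis nI_eq : idprod n I = npow 2.
Implicit Types (x y z p q r s t u v w : R).

Let npow_id := npow_ideal loc.
Let i1 : is_ideal (npow 1) := npow_id 1.
Let len_emb : len (npow 1) n 3 := proj1 (num_gens_len loc noeth 3 loc) emb.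
Let sq_n : psub (npow 1) n := npowS loc (k := 0).
Hint Resolve iI i1 : core.

Lemma sq_mul_I w x : npow 1 w -> n x -> I (w * x).
Proof. by move=> hw nx; apply: n3I; rewrite mulrC; apply: mem_idprod. Qed.

Lemma mul_sq a b : n a -> n b -> npow 1 (a * b).
Proof. exact: mem_idprod. Qed.

Lemma kill_sq a m : n a -> n m -> npow 1 (m * a).
Proof. by move=> na nm; apply: mem_idprod. Qed.

Lemma nonunit_not_adj a : n a -> ~ psub n (adj (npow 1) a).
Proof.
move=> na h.
have e : adds (npow 1) [:: a] = n.
  by apply: psub_anti => //; apply: adj_min.
have l : len (npow 1) (adds (npow 1) [:: a]) 3 by rewrite e.
suff : (3 <= 1)%N by [].
by apply: (len_gen_le _ l) => b m; rewrite inE => /eqP ->; apply: kill_sq.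
Qed.

Lemma nonunit_not_sq : exists a, n a /\ ~ npow 1 a.
Proof.
apply: not_psub => h; apply: (@nonunit_not_adj 0); first exact: ideal_zero.
by apply: psub_trans h _; apply: sub_adj.
Qed.

Lemma indep_gens3 a b c : n a -> n b -> n c ->
  indep (npow 1) [:: a; b; c] -> gens3 a b c.
Proof.
move=> na nb nc ind; split=> // w.
have sn u : u \in [:: a; b; c] -> n u by rewrite !inE => /or3P[] /eqP ->.
have e : adds (npow 1) [:: a; b; c] = n.
  apply: (len_indep_full len_emb sn) => // u m /sn; exact: kill_sq.
have iO := adds_ideal [:: a; b; c] (@pzero_ideal R).
have h : psub n (adds (@pzero R) [:: a; b; c]).
  by apply: (nakayama noeth loc) => // u; rewrite -{1}e adds_psum // psumC.
move=> /h [r [s [t]]] /eqP; rewrite subr_eq0 subr_eq subr_eq => /eqP ->.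
by exists t, s, r; ring.
Qed.

Lemma complete_gens3 a b : n a -> n b -> ~ npow 1 a -> ~ adj (npow 1) a b ->
  exists t, n t /\ indep (npow 1) [:: a; b; t].
Proof.
move=> na nb ha hb.
have sn u : u \in [:: a; b] -> n u by rewrite !inE => /orP[] /eqP ->.
have [t [nt ht]] : exists t, n t /\ ~ adds (npow 1) [:: a; b] t.
  apply: not_psub => h.
  have e : adds (npow 1) [:: a; b] = n by apply: psub_anti => //; apply: adds_min.
  have l : len (npow 1) (adds (npow 1) [:: a; b]) 3 by rewrite e.
  suff : (3 <= 2)%N by [].
  by apply: (len_gen_le _ l) => u m /sn; apply: kill_sq.
by exists t.
Qed.

(* image x is xn + I, so x is good when multiplication by x maps n onto n^2/I. *)
Definition image x : pset R := fun z => exists y, n y /\ I (z - x * y).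
Definition good x := psub (npow 1) (image x).
Definition bad x := [/\ n x, ~ npow 1 x & ~ good x].
Definition perp x : pset R := fun y => I (y * x).

Lemma image_ideal x : is_ideal (image x).
Proof.
split.
- exists 0; split; first exact: ideal_zero.
  by apply: ideal_conv (ideal_zero iI) _; ring.
- move=> a b [y [ny h]] [y' [ny' h']]; exists (y + y'); split; first exact: ideal_add.
  by apply: ideal_conv (ideal_add iI h h') _; ring.
- move=> c a [y [ny h]]; exists (c * y); split; first exact: ideal_mul.
  by apply: ideal_conv (ideal_mul c iI h) _; ring.
Qed.

Lemma I_image x : psub I (image x).
Proof.
move=> z Iz; exists 0; split; first exact: ideal_zero.
by rewrite mulr0 subr0.
Qed.

Lemma image_sq x : n x -> psub (image x) (npow 1).
Proof.
move=> nx z [y [ny h]].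
by apply: ideal_conv (ideal_add i1 (In2 h) (mul_sq nx ny)) _; ring.
Qed.

Lemma mem_image x y : n y -> image x (x * y).
Proof. by move=> ny; exists y; split=> //; rewrite subrr; apply: ideal_zero. Qed.

Lemma perp_ideal x : is_ideal (perp x).
Proof.
split; rewrite /perp.
- by rewrite mul0r; apply: ideal_zero.
- by move=> a b ha hb; rewrite mulrDl; apply: ideal_add.
- by move=> r a ha; rewrite -mulrA; apply: ideal_mul.
Qed.

Lemma sq_perp x : n x -> psub (npow 1) (perp x).
Proof. by move=> nx w hw; apply: sq_mul_I. Qed.

Lemma not_sq_sub_I : ~ psub (npow 1) I.
Proof.
by move=> h; have := len_refl_eq0 len_sq (psub_anti h In2).
Qed.

Lemma sq_not_good x : npow 1 x -> ~ good x.
Proof.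
move=> hx h; apply: not_sq_sub_I => z /h [y [ny hz]].
by apply: ideal_conv (ideal_add iI hz (sq_mul_I hx ny)) _; ring.
Qed.

Lemma bad_not_soc p : bad p -> exists y, n y /\ ~ perp p y.
Proof.
move=> [np np2 _]; apply: not_psub => h; apply: np2; apply: soc_sq => // y ny.
by rewrite mulrC; apply: h.
Qed.

(** The image lies strictly between [I] and n^2, two steps apart: it is not [I] because the socle
    lies in n^2 and [p] does not. *)
Lemma bad_step p : bad p -> comp_step I (image p).
Proof.
move=> bp; have [np np2 ngood] := bp.
have [a [b [h1 h2 e]]] := len_split len_sq (image_ideal p) (@I_image p) (image_sq np).
have a0 : a <> 0%N.
  move=> a0; rewrite a0 in h1; have [y [ny hy]] := bad_not_soc bp.
  by apply: hy; rewrite /perp mulrC (len_zero h1); apply: mem_image.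
have b0 : b <> 0%N.
  by move=> b0; rewrite b0 in h2; apply: ngood; rewrite /good (len_zero h2).
by apply: len1_step; have <- : a = 1%N by lia.
Qed.

Lemma bad_image p y : bad p -> n y -> ~ I (p * y) -> image p = adj I (p * y).
Proof.
move=> bp ny h; have [_ simple] := bad_step bp.
have sub : psub (adj I (p * y)) (image p).
  by apply: adj_min; [exact: image_ideal|exact: I_image|exact: mem_image].
apply: psub_anti => //.
have [||| hh |//] := simple (adj I (p * y)) => //.
- exact: adj_ideal.
- exact: sub_adj.
- by case: h; apply: hh; apply: mem_adj.
Qed.

(* Otherwise a linear functional on n^2/I would have rank one as a quadratic
   form, and then n^3 = nI would lie in (p, p') + n^4. *)
Lemma bad_image_neq p p' : bad p -> bad p' -> ~ adj (npow 1) p p' ->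
  image p <> image p'.
Proof.
move=> [np np2 ngood] [np' _ _] hpp e.
have [t [nt ind]] := complete_gens3 np np' np2 hpp.
have g := indep_gens3 np np' nt ind; have [_ _ _ gen] := g.
have iD := image_ideal p.
have Dp y : n y -> image p (p * y) by apply: mem_image.
have Dp' y : n y -> image p (p' * y) by rewrite e; apply: mem_image.
(* All products of generators involving [p] or [p'] are in the common image, so with [t * t] it
   would be all of n^2. *)
have ntt : ~ image p (t * t).
  move=> htt; apply: ngood; apply: idprod_min => //.
  move=> x y /gen [a [b [c ->]]] /gen [a' [b' [c' ->]]].
  have m1 : n (a' * p + b' * p' + c' * t).
    by apply: ideal_add; [|apply: ideal_add|]; do ?apply: ideal_mul.
  have m2 : n (a * p + b * p' + c * t).
    by apply: ideal_add; [|apply: ideal_add|]; do ?apply: ideal_mul.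
  apply: ideal_conv (ideal_add iD (ideal_add iD (ideal_mul a iD (Dp _ m1))
    (ideal_mul b iD (Dp' _ m1))) (ideal_add iD (ideal_add iD
    (ideal_mul (c * a') iD (Dp _ nt)) (ideal_mul (c * b') iD (Dp' _ nt)))
    (ideal_mul (c * c') iD htt))) _.
  by ring.
pose T := adds (@pzero R) [:: p; p'].
have iT : is_ideal T by apply/adds_ideal/pzero_ideal.
(* For the same reason the coefficient of [t * t] in an element of [I] is a nonunit. *)
have IT f : I f -> exists w, npow 2 w /\ T (f - w).
  move=> If; have [c1 [c2 [c3 [c4 [c5 [c6 ef]]]]]] := npow1_gens3 g (In2 If).
  have nc3 : n c3.
    apply: NNPP => uc; apply: ntt; apply: (unit_cancel iD uc).
    have nl : n (c1 * p + c4 * p' + c5 * t).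
      by apply: ideal_add; [|apply: ideal_add|]; do ?apply: ideal_mul.
    have nl' : n (c2 * p' + c6 * t).
      by apply: ideal_add; do ?apply: ideal_mul.
    apply: ideal_conv (ideal_sub iD (ideal_sub iD (I_image p If) (Dp _ nl)) (Dp' _ nl')) _.
    by rewrite ef /quad3; ring.
  exists (c3 * (t * t)); split; first by apply: mem_idprod => //; apply: mul_sq.
  exists (c2 * p' + c6 * t), (c1 * p + c4 * p' + c5 * t).
  by rewrite ef /quad3 /pzero; ring.
suff : (3 <= 2)%N by [].
apply: (param_bound noeth loc chain (s := [:: p; p']) (k := 2)).
  by move=> a; rewrite !inE => /orP[] /eqP ->.
rewrite -{1}nI_eq; apply: idprod_min; first exact: psum_ideal.
move=> a f na /IT [w [hw hT]].
exists (a * (f - w)), (a * w); split; [exact: ideal_mul|exact: mem_idprod|ring].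
Qed.

(** If the product were outside [I], it would generate both images modulo [I], against
    [bad_image_neq]. *)
Lemma bad_orthogonal p p' : bad p -> bad p' -> ~ adj (npow 1) p p' -> I (p * p').
Proof.
move=> bp bp' h; apply: NNPP => hI; apply: (bad_image_neq bp bp' h).
have [np _ _] := bp; have [np' _ _] := bp'.
rewrite (bad_image bp np' hI) (bad_image bp' np); first by rewrite mulrC.
by rewrite mulrC.
Qed.

(** Multiplication by [x] maps the three-dimensional n/n^2 to the two-dimensional n^2/I, so it has a
    kernel. *)
Lemma good_annihilator x : n x -> good x -> exists y, [/\ n y, ~ npow 1 y & I (x * y)].
Proof.
move=> nx gx; apply: NNPP => none.
have ann y : n y -> I (x * y) -> npow 1 y.
  by move=> ny h; apply: NNPP => ny2; apply: none; exists y.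
have [a [na ha]] := nonunit_not_sq.
have [b [nb hb]] := not_psub (nonunit_not_adj na).
have [t [nt [_ [_ [ht _]]]]] := complete_gens3 na nb ha hb.
suff : (3 <= 2)%N by [].
apply: (len_indep_le (s := [:: x * a; x * b; x * t]) len_sq).
- by move=> u; rewrite !inE => /or3P[] /eqP ->; apply: mul_sq.
- by move=> u m; rewrite !inE => /or3P[] /eqP -> nm; rewrite mulrC;
    apply: sq_mul_I => //; apply: mul_sq.
split; first by move=> h; apply: ha; apply: ann.
split.
  move=> [r h]; apply: hb; exists r; apply: ann.
    by apply: ideal_sub => //; apply: ideal_mul.
  by apply: ideal_conv h _; ring.
split=> // -[r [s h]]; apply: ht; exists r, s; apply: ann.
  by apply: ideal_sub => //; [apply: ideal_sub|]; do ?apply: ideal_mul.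
by apply: ideal_conv h _; ring.
Qed.

Lemma adj_sym p q : bad p -> adj (npow 1) p q -> ~ npow 1 q -> adj (npow 1) q p.
Proof.
move=> [np _ _] [r h] nq.
have ur : ~ n r.
  move=> nr; apply: nq.
  by apply: ideal_conv (ideal_add i1 h (mul_sq nr np)) _; ring.
have [v ev] := unit_of ur; exists v.
apply: ideal_conv (ideal_mul (- v) i1 h) _.
have -> : - v * (q - r * p) = (r * v) * p - v * q by ring.
by rewrite ev mul1r.
Qed.

(** A group is not the union of two proper subgroups; this needs no assumption on the size of the
    residue field. *)
Lemma avoid2 X Y : is_ideal X -> is_ideal Y -> ~ psub n X -> ~ psub n Y ->
  exists x, [/\ n x, ~ X x & ~ Y x].
Proof.
move=> iX iY /not_psub [a [na ha]] /not_psub [b [nb hb]].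
case: (classic (Y a)) => ya; last by exists a.
case: (classic (X b)) => xb; last by exists b.
exists (a + b); split; first exact: ideal_add.
- by move=> h; apply: ha; apply: ideal_conv (ideal_sub iX h xb) _; ring.
- by move=> h; apply: hb; apply: ideal_conv (ideal_sub iY h ya) _; ring.
Qed.

Lemma bad_perp p : bad p -> ~ psub n (perp p).
Proof. by move=> /bad_not_soc [y [ny hy]] h; apply/hy/h. Qed.

Lemma adj_perp p q : n q -> I (p * q) -> psub (adj (npow 1) p) (perp q).
Proof.
by move=> nq h; apply: adj_min; [exact: perp_ideal|exact: sq_perp|].
Qed.

Lemma good_of_not_perp p x : bad p -> n x -> ~ perp p x -> ~ adj (npow 1) p x -> good x.
Proof.
move=> bp nx hx ax; apply: NNPP => ngx; apply: hx; rewrite /perp mulrC.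
apply: bad_orthogonal => //; split=> // h; apply: ax; exact: sub_adj.
Qed.

(** If [y] were on the line of [p] modulo n^2, its coefficient would be a unit and [x] would
    annihilate [p]. *)
Lemma not_adj_of_not_perp p x y : bad p -> bad y -> n x -> ~ perp p x -> I (x * y) ->
  ~ adj (npow 1) p y.
Proof.
move=> [np _ _] [ny ny2 _] nx hx hxy [r hr].
case: (classic (n r)) => nr.
  by apply: ny2; apply: ideal_conv (ideal_add i1 hr (mul_sq nr np)) _; ring.
apply: hx; apply: (unit_cancel iI nr).
by apply: ideal_conv (ideal_sub iI hxy (sq_mul_I hr nx)) _; ring.
Qed.

(** * Refuting the case where no two good elements have product in [I] *)

Section NoPair.
Hypothesis none : forall x y, n x -> n y -> good x -> good y -> ~ I (x * y).

Lemma good_bad x : n x -> good x -> exists y, bad y /\ I (x * y).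
Proof.
move=> nx gx; have [y [ny ny2 h]] := good_annihilator nx gx.
by exists y; split=> //; split=> // gy; apply: (none nx ny).
Qed.

(** With [t] outside the annihilator of [p], the elements p, q, t generate n and that annihilator is
    (p, q) + n^2. The bad partner [y] of [t] then annihilates all three generators and falls into
    the socle. *)
Lemma isotropic_contra p q r : bad p -> bad q -> bad r ->
  ~ adj (npow 1) p q -> ~ adj (npow 1) p r ->
  I (p * q) -> I (p * r) -> I (q * r) -> I (p * p) -> False.
Proof.
move=> bp bq br apq apr pq pr qr pp.
have [np np2 _] := bp; have [nq _ _] := bq; have [nr _ _] := br.
have [t [nt ht]] := not_psub (bad_perp bp).
have pqperp : psub (adj (adj (npow 1) p) q) (perp p).
  apply: adj_min; [exact: perp_ideal|exact: adj_perp|by rewrite /perp mulrC].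
have [_ _ _ gen] : gens3 p q t.
  apply: indep_gens3 => //; split=> //; split=> //; split=> // h.
  by apply: ht; apply: pqperp.
have span y : n y -> perp p y -> exists a b, npow 1 (y - a * p - b * q).
  move=> /gen [a [b [c ->]]] h; exists a, b.
  have nc : n c.
    apply: NNPP => uc; apply: ht; apply: (unit_cancel iI uc).
    apply: ideal_conv (ideal_sub iI (ideal_sub iI h (ideal_mul a iI pp)) (ideal_mul b iI pq)) _.
    by ring.
  by apply: ideal_conv (mul_sq nc nt) _; ring.
(* Modulo n^2, [r] is a combination of [p] and [q] with unit coefficient at [q], and it annihilates
   [q]. *)
have qq : I (q * q).
  have [a [b h]] : exists a b, npow 1 (r - a * p - b * q).
    by apply: span => //; rewrite /perp mulrC.
  have ub : ~ n b.
    move=> nb; apply: apr; exists a.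
    by apply: ideal_conv (ideal_add i1 h (mul_sq nb nq)) _; ring.
  apply: (unit_cancel iI ub).
  apply: ideal_conv (ideal_sub iI (ideal_sub iI qr (ideal_mul a iI pq)) (sq_mul_I h nq)) _.
  by ring.
have at_ : ~ adj (npow 1) p t by move=> h; apply: ht; apply: adj_perp h.
have gt : good t by apply: (good_of_not_perp bp).
have [y [byy ty]] := good_bad nt gt; have [ny ny2 _] := byy.
have apy := not_adj_of_not_perp bp byy nt ht ty.
have py := bad_orthogonal bp byy apy.
have [|a [b h]] := span y ny; first by rewrite /perp mulrC.
apply: ny2; apply: soc_sq => // m /gen [a' [b' [c' ->]]].
have yq : I (y * q).
  apply: ideal_conv (ideal_add iI (ideal_add iI (ideal_mul a iI pq) (ideal_mul b iI qq))
    (sq_mul_I h nq)) _.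
  by ring.
apply: ideal_conv (ideal_add iI (ideal_add iI (ideal_mul a' iI py) (ideal_mul b' iI yq))
  (ideal_mul c' iI ty)) _.
by ring.
Qed.

(** Bad partners of suitably chosen good elements yield three pairwise orthogonal bad elements on
    distinct lines. None has its square in [I], so they generate n and their sum is orthogonal to
    none of them. *)
Lemma no_pair_contra : False.
Proof.
have [p1 b1] : exists p, bad p.
  have [a [na ha]] := nonunit_not_sq.
  case: (classic (good a)) => ga; last by exists a.
  by have [y [b _]] := good_bad na ga; exists y.
have [n1 s1 _] := b1.
have [x [nx hx ax]] := avoid2 (perp_ideal p1) (adj_ideal p1 i1) (bad_perp b1)
  (nonunit_not_adj n1).
have [p2 [b2 xp2]] := good_bad nx (good_of_not_perp b1 nx hx ax).
have [n2 s2 _] := b2.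
have a12 := not_adj_of_not_perp b1 b2 nx hx xp2.
have o12 := bad_orthogonal b1 b2 a12.
have o21 : I (p2 * p1) by rewrite mulrC.
have [x' [nx' hx1 hx2]] := avoid2 (perp_ideal p1) (perp_ideal p2) (bad_perp b1) (bad_perp b2).
have ax' : ~ adj (npow 1) p1 x' by move=> h; apply: hx2; apply: adj_perp h.
have [p3 [b3 xp3]] := good_bad nx' (good_of_not_perp b1 nx' hx1 ax').
have [n3 s3 _] := b3.
have a13 := not_adj_of_not_perp b1 b3 nx' hx1 xp3.
have a23 := not_adj_of_not_perp b2 b3 nx' hx2 xp3.
have o13 := bad_orthogonal b1 b3 a13; have o23 := bad_orthogonal b2 b3 a23.
have a21 : ~ adj (npow 1) p2 p1 by move=> h; apply/a12/adj_sym.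
have a31 : ~ adj (npow 1) p3 p1 by move=> h; apply/a13/adj_sym.
have a32 : ~ adj (npow 1) p3 p2 by move=> h; apply/a23/adj_sym.
have o31 : I (p3 * p1) by rewrite mulrC.
have o32 : I (p3 * p2) by rewrite mulrC.
have q1 : ~ I (p1 * p1) by apply: (isotropic_contra b1 b2 b3).
have q2 : ~ I (p2 * p2) by apply: (isotropic_contra b2 b1 b3).
have q3 : ~ I (p3 * p3) by apply: (isotropic_contra b3 b1 b2).
pose w := p1 + p2 + p3.
have nw : n w by apply: ideal_add => //; apply: ideal_add.
have w1 : ~ perp p1 w.
  by move=> h; apply: q1; apply: ideal_conv (ideal_sub iI (ideal_sub iI h o21) o31) _;
    rewrite /w; ring.
have w2 : ~ perp p2 w.
  by move=> h; apply: q2; apply: ideal_conv (ideal_sub iI (ideal_sub iI h o12) o32) _;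
    rewrite /w; ring.
have w3 : ~ perp p3 w.
  by move=> h; apply: q3; apply: ideal_conv (ideal_sub iI (ideal_sub iI h o13) o23) _;
    rewrite /w; ring.
have aw : ~ adj (npow 1) p1 w by move=> h; apply: w2; apply: adj_perp h.
(* The bad partner of the sum is off all three lines, hence orthogonal to a generating set of n: it
   lies in the socle, thus in n^2, and is not bad. *)
have [p4 [b4 wp4]] := good_bad nw (good_of_not_perp b1 nw w1 aw).
have [n4 s4 _] := b4.
have orth p : bad p -> ~ perp p w -> I (p4 * p).
  move=> bp hp; rewrite mulrC; apply: bad_orthogonal => //.
  exact: (not_adj_of_not_perp bp b4 nw).
have sub3 : psub (adj (adj (npow 1) p1) p2) (perp p3).
  by apply: adj_min; [exact: perp_ideal|exact: adj_perp|].
have [_ _ _ gen] : gens3 p1 p2 p3.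
  by apply: indep_gens3 => //; split=> //; split=> //; split=> // /sub3.
apply: s4; apply: soc_sq => // m /gen [a [b [c ->]]].
apply: ideal_conv (ideal_add iI (ideal_add iI (ideal_mul a iI (orth p1 b1 w1))
  (ideal_mul b iI (orth p2 b2 w2))) (ideal_mul c iI (orth p3 b3 w3))) _.
by ring.
Qed.
End NoPair.

Lemma good_pair : exists x y, [/\ n x, n y, good x, good y & I (x * y)].
Proof.
apply: NNPP => none; apply: no_pair_contra => x y nx ny gx gy h.
by apply: none; exists x, y.
Qed.

(** If [z] were outside (y) + n^2, then [x] would annihilate two of three generators of n, and n^2 =
    xn + I would have length at most one over [I]. *)
Lemma good_pair_exact x y z : n x -> n y -> good x -> good y -> I (x * y) ->
  I (z * x) -> exists r, I (z - r * y).
Proof.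
move=> nx ny gx gy xy zx.
have nz : n z.
  apply: NNPP => uz; apply: (sq_not_good _ gx); apply: In2.
  exact: unit_cancel zx.
have [r hr] : adj (npow 1) y z.
  apply: NNPP => hz.
  have ny2 : ~ npow 1 y by move=> h; apply: sq_not_good gy.
  have [t [nt ind]] := complete_gens3 ny nz ny2 hz.
  have [_ _ _ gen] := indep_gens3 ny nz nt ind.
  have e : adds I [:: x * t] = npow 1.
    apply: psub_anti.
      by apply: adds_min => // a; rewrite inE => /eqP ->; apply: mul_sq.
    move=> v /gx [m [/gen [a [b [c ->]]] h]]; exists c.
    apply: ideal_conv (ideal_add iI h (ideal_add iI (ideal_mul a iI xy) (ideal_mul b iI zx))) _.
    by ring.
  have l := len_sq; rewrite -e in l.
  suff : (2 <= 1)%N by [].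
  apply: (len_gen_le _ l) => a m; rewrite inE => /eqP -> nm; rewrite mulrC.
  by apply: sq_mul_I => //; apply: mul_sq.
(* The remainder in n^2 is absorbed because [y] is good. *)
have [m [nm hm]] := gy _ hr; exists (r + m).
by apply: ideal_conv hm _; ring.
Qed.
End ExactPair.

(** * Passage to the quotient ring *)

Section Quotient.
Variables (S Q : comNzRingType) (pi : {rmorphism S -> Q}) (I : pset S).
Hypothesis iI : is_ideal I.
Hypothesis surj : forall q, exists s, pi s = q.
Hypothesis ker : forall s, pi s = 0 <-> I s.

Definition pimage (X : pset S) : pset Q := fun q => exists s, X s /\ pi s = q.

Lemma pimage_ideal X : is_ideal X -> is_ideal (pimage X).
Proof.
move=> iX; split.
- by exists 0; split; [apply: ideal_zero|rewrite rmorph0].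
- move=> _ _ [s [Xs <-]] [t [Xt <-]]; exists (s + t).
  by split; [apply: ideal_add|rewrite rmorphD].
- move=> r _ [s [Xs <-]]; have [t <-] := surj r; exists (t * s).
  by split; [apply: ideal_mul|rewrite rmorphM].
Qed.

Lemma mem_pimage X s : is_ideal X -> psub I X -> pimage X (pi s) -> X s.
Proof.
move=> iX IX [t [Xt e]]; have : I (s - t) by apply/ker; rewrite rmorphB e subrr.
by move=> /IX h; apply: ideal_conv (ideal_add iX h Xt) _; ring.
Qed.

Lemma pimage_ker : pimage I = @pzero Q.
Proof.
apply: psub_anti => [_ [s [/ker Is <-]] //|q ->].
by exists 0; split; [apply: ideal_zero|rewrite rmorph0].
Qed.

(** An intermediate ideal of the quotient is contracted along [pi], where the given step is
    simple. *)
Lemma comp_step_pimage X Y : is_ideal X -> is_ideal Y -> psub I X ->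
  comp_step X Y -> comp_step (pimage X) (pimage Y).
Proof.
move=> iX iY IX [[XY [y [Yy nXy]]] simple]; split; first split.
- by move=> _ [s [Xs <-]]; exists s; split=> //; apply: XY.
- by exists (pi y); split; [exists y|move=> /(mem_pimage iX IX)].
move=> C iC XC CY; pose C' : pset S := fun s => C (pi s).
have iC' : is_ideal C'.
  split; rewrite /C'.
  - by rewrite rmorph0; apply: ideal_zero.
  - by move=> a b ha hb; rewrite rmorphD; apply: ideal_add.
  - by move=> r a ha; rewrite rmorphM; apply: ideal_mul.
have [|| h | h] := simple C' iC'.
- by move=> x Xx; apply: XC; exists x.
- by move=> x /CY; apply: mem_pimage => // z /IX /XY.
- by left=> q; have [s <-] := surj q => /h Xs; exists s.
- by right=> _ [s [/h Cs <-]].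
Qed.

Lemma len_pimage X k : len I X k -> len (@pzero Q) (pimage X) k.
Proof.
elim=> [_|Y Z j l IH iZ st]; first by rewrite pimage_ker; apply/len0/pzero_ideal.
have [_ iY IY] := len_id l.
by apply: (lenS IH); [apply: pimage_ideal|apply: comp_step_pimage].
Qed.

Hypothesis loc : local_ring S.
Hypothesis In : psub I (@nonunit S).

Lemma nonunit_quotient s : nonunit (pi s) <-> nonunit s.
Proof.
split.
  by move=> h [t st]; apply: h; exists (pi t); rewrite -rmorphM st rmorph1.
move=> ns [q]; have [t <-] := surj q => e.
have /In h : I (1 - s * t) by apply/ker; rewrite rmorphB rmorph1 rmorphM e subrr.
apply: (nonunit_n1 (R := S)).
by apply: ideal_conv (ideal_add loc h (ideal_mulr t loc ns)) _; ring.
Qed.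

Lemma pimage_soc : pimage (colon I (@nonunit S)) = colon (@pzero Q) (@nonunit Q).
Proof.
apply: psub_anti.
  move=> _ [s [hs <-]] q; have [t <-] := surj q => /nonunit_quotient nt.
  by rewrite /pzero -rmorphM; apply/ker/hs.
move=> q; have [s <-] := surj q => hs; exists s; split=> // t /nonunit_quotient nt.
by apply/ker; rewrite rmorphM; apply: hs.
Qed.

Lemma art_type_quotient k : len I (colon I (@nonunit S)) k -> art_type Q k.
Proof. by move=> /len_pimage; rewrite pimage_soc => /lenP. Qed.

Lemma exact_zd_pair_quotient x y : nonunit x -> nonunit y -> I (x * y) ->
  (forall z, I (z * x) -> exists r, I (z - r * y)) ->
  (forall z, I (z * y) -> exists r, I (z - r * x)) ->
  exact_zd_pair (pi x) (pi y).
Proof.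
move=> nx ny xy hx hy.
have half u v : I (u * v) -> (forall z, I (z * u) -> exists r, I (z - r * v)) ->
    forall q, q * pi u = 0 <-> principal (pi v) q.
  move=> uv h q; have [z <-] := surj q; split.
    rewrite -rmorphM => /ker /h [r hr]; exists (pi r).
    by apply/eqP; rewrite -subr_eq0 -rmorphM -rmorphB; apply/eqP/ker.
  move=> [q' ->]; have [r <-] := surj q'; rewrite -!rmorphM; apply/ker.
  by apply: ideal_conv (ideal_mul r iI uv) _; ring.
split; [exact/nonunit_quotient|exact/nonunit_quotient|exact: half|].
by apply: half => //; rewrite mulrC.
Qed.

End Quotient.

Theorem theorem5p3 (S : comNzRingType) (I : pset S) :
  regular_local S ->
  max_primary I ->
  psub I (idprod (@nonunit S) (@nonunit S)) ->
  ideal_length I (@pfull S) 6 ->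
  forall (Q : comNzRingType) (pi : {rmorphism S -> Q}),
    (forall q, exists s, pi s = q) ->
    (forall s, pi s = 0 <-> I s) ->
    ~ art_gorenstein Q ->
    ~ art_burch Q ->
    [/\ krull_dim S 3, art_type Q 2, num_gens I 4
      & exists x y : Q, exact_zd_pair x y].
Proof.
move=> reg [[iI _ _] radI] In2 /lenP l6 Q pi surj ker ngor nburch.
have [noeth loc [d [kd emb]]] := reg; have [chain _] := kd.
have In : psub I (@nonunit S) by move=> x /In2; apply: npow1_n.
have rad x : nonunit x -> exists k, I (x ^+ k) by move=> /radI.
have nb : idprod (@nonunit S) (colon I (@nonunit S)) = idprod (@nonunit S) I.
  apply: peq_eq; apply: NNPP => hb; apply: nburch.
  (* The presentation of [Q] by S and I itself would witness that [Q] is Burch. *)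
  by exists S, I, pi.
have ng : ~ comp_step I (colon I (@nonunit S)).
  move=> st; apply: ngor; apply: (art_type_quotient iI surj ker loc In).
  by apply: (lenS (len0 iI)) => //; apply: colon_ideal.
have [d3 n3I l2] := dim3_data noeth loc chain emb iI In2 rad l6 nb ng.
have es := soc_eq noeth loc chain emb iI In2 rad l6 nb ng.
have nI := idprod_I noeth loc chain emb iI In2 rad l6 nb ng.
split.
- by rewrite -d3.
(* The socle is n^2/I, of length two. *)
- by apply: (art_type_quotient iI surj ker loc In); rewrite es.
- exact: (num_gens_I noeth loc chain emb iI In2 rad l6 nb ng).
rewrite d3 in chain emb.
have soc_sq x : nonunit x -> (forall y, nonunit y -> I (x * y)) -> npow (R := S) 1 x.
  by move=> nx hx; rewrite -es.
have [x [y [nx ny gx gy xy]]] :=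
  good_pair noeth loc chain emb iI In2 n3I l2 soc_sq nI.
exists (pi x), (pi y); apply: (exact_zd_pair_quotient iI surj ker loc In) => // z.
  exact: (good_pair_exact noeth loc emb iI In2 n3I l2 nx ny gx gy).
apply: (good_pair_exact noeth loc emb iI In2 n3I l2 ny nx gy gx).
by rewrite mulrC.
Qed.
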